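(* Let $k\geq 2$ be an integer and $\epsilon>0$ a real number. Suppose $h\in\mathbb{R}[x_1,\ldots,x_n]$ is hyperbolic with respect to $\mathbf{e}\in\mathbb{R}^n$, and let $\mathbf{u}_1,\ldots,\mathbf{u}_m\in\Lambda_+(\mathbf{e})$ be such that $\operatorname{rk}(\mathbf{u}_i)\leq 1$ and $\operatorname{tr}(\mathbf{u}_i)\leq\epsilon$ for all $1\leq i\leq m$, and $\mathbf{u}_1+\cdots+\mathbf{u}_m=\mathbf{e}$. Then there is a partition $S_1\cup S_2\cup\cdots\cup S_k=[m]$ such that $$\Big\|\sum_{i\in S_j}\mathbf{u}_i\Big\|\leq \frac1k\,\delta(k\epsilon,m)\quad\text{for each } j\in[k],$$ where $\delta(\alpha,m):=\Big(1-\frac1m+\sqrt{\alpha-\frac1m\big(1-\frac1m\big)}\Big)^2$.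
   Context: A homogeneous polynomial $h\in\mathbb{R}[x_1,\ldots,x_n]$ of degree $d$ is hyperbolic with respect to $\mathbf{e}\in\mathbb{R}^n$ if $h(\mathbf{e})\neq0$ and for every $\mathbf{x}\in\mathbb{R}^n$ the univariate polynomial $t\mapsto h(t\mathbf{e}-\mathbf{x})$ has only real zeros. Writing $h(t\mathbf{e}-\mathbf{x})=h(\mathbf{e})\prod_{j=1}^d(t-\lambda_j(\mathbf{x}))$ with $\lambda_1(\mathbf{x})\geq\cdots\geq\lambda_d(\mathbf{x})$, these are the eigenvalues of $\mathbf{x}$ (with respect to $\mathbf{e}$). The closed hyperbolicity cone is $\Lambda_+(\mathbf{e})=\{\mathbf{x}:\lambda_d(\mathbf{x})\geq0\}$. Define $\operatorname{tr}(\mathbf{x})=\sum_i\lambda_i(\mathbf{x})$, $\operatorname{rk}(\mathbf{x})=\#\{i:\lambda_i(\mathbf{x})\neq0\}$, and $\|\mathbf{x}\|=\max_i|\lambda_i(\mathbf{x})|$. $[m]=\{1,\ldots,m\}$. *)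

(* Defs.v *)
From HB Require Import structures.
From Stdlib Require Import Reals ClassicalEpsilon.
From mathcomp Require Import all_boot all_order all_algebra.
From mathcomp Require Import mpoly.
From mathcomp Require Import complex.
From mathcomp Require Import Rstruct.

Set Implicit Arguments.
Unset Strict Implicit.
Unset Printing Implicit Defensive.

Import Order.TTheory GRing.Theory Num.Theory.
Local Open Scope ring_scope.

Notation RR := Rdefinitions.R.

Definition restr_poly (n : nat) (h : {mpoly RR[n]}) (e x : 'rV[RR]_n) : {poly RR} :=
  mmap (@polyC RR) (fun j => e ord0 j *: 'X - (x ord0 j)%:P) h.

Definition ev (n : nat) (h : {mpoly RR[n]}) (v : 'rV[RR]_n) : RR :=
  h.@[fun j => v ord0 j].

(* h is hyperbolic w.r.t. e: h homogeneous (of some degree d, given separately),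
   h(e) <> 0, and for every x all complex zeros of t |-> h(t e - x) are real *)
Definition hyperbolic (n : nat) (h : {mpoly RR[n]}) (e : 'rV[RR]_n) : Prop :=
  ev h e != 0 /\
  forall x : 'rV[RR]_n, forall z : RR[i],
    root (map_poly (fun a : RR => (a%:C)%C) (restr_poly h e x)) z ->
    complex.Im z = 0.

Definition eig_spec (n : nat) (h : {mpoly RR[n]}) (e x : 'rV[RR]_n) (s : seq RR) : Prop :=
  restr_poly h e x = (ev h e)%:P * \prod_(l <- s) ('X - l%:P).

(* the eigenvalues of x w.r.t. e (a list, unique up to permutation when h is
   hyperbolic; all quantities below are permutation invariant) *)
Definition eigs (n : nat) (h : {mpoly RR[n]}) (e x : 'rV[RR]_n) : seq RR :=
  epsilon (inhabits [::]) (eig_spec h e x).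

Definition hcone (n : nat) (h : {mpoly RR[n]}) (e x : 'rV[RR]_n) : Prop :=
  all (fun l => 0 <= l) (eigs h e x).

Definition htr (n : nat) (h : {mpoly RR[n]}) (e x : 'rV[RR]_n) : RR :=
  \sum_(l <- eigs h e x) l.

Definition hrk (n : nat) (h : {mpoly RR[n]}) (e x : 'rV[RR]_n) : nat :=
  count (fun l => l != 0) (eigs h e x).

Definition hnorm (n : nat) (h : {mpoly RR[n]}) (e x : 'rV[RR]_n) : RR :=
  \big[Num.max/0]_(l <- eigs h e x) `|l|.

Definition delta (alpha : RR) (m : nat) : RR :=
  (1 - (m%:R)^-1 + Num.sqrt (alpha - (m%:R)^-1 * (1 - (m%:R)^-1))) ^+ 2.

(* Main.v *)
Require Import Defs.
From HB Require Import structures.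
From Stdlib Require Import Reals.
From mathcomp Require Import all_boot all_order all_algebra.
From mathcomp Require Import mpoly complex Rstruct.
From mathcomp Require Import polyrcf ring lra.
Import Order.TTheory GRing.Theory Num.Theory.
Local Open Scope ring_scope.
Set Implicit Arguments.
Unset Strict Implicit.
Unset Printing Implicit Defensive.

(** * Idea

    Write p(x) = h(sum_i x_i u_i) / h(e).  Garding's convexity theorem makes p
    real stable, and rank at most 1 makes it affine in each variable.  For a
    random f : [m] -> [k], averaging the product over j of p(t 1 - k 1_(f = j))
    amounts to applying the operators 1 - D_i, where D_i = sum_j d/dx_i^j, to
    p(x^1) ... p(x^k).  Deciding f(i) one index at a time, some choice always
    keeps positivity on a half-line [T, oo), because D_i F / F is nonincreasing
    there; so it suffices to bound the largest zero of the average.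

    That bound is the barrier argument of Marcus, Spielman and Srivastava in the
    homogeneous form of Branden: with G(x, y) obtained from the operators
    1 + y_i D_i, the convexity of the hyperbolicity cone of G yields the concavity
    of F / D_i F needed to move a barrier, and, applied once more at the end,
    averages m certificates, one for each choice of the operator applied last.
    This last average is what produces 1 - 1/m in place of 1.

    Garding's theorem itself follows from a homotopy: zeros of polynomials that
    never meet the real line cannot leave a half-plane. *)

(** * Zeros of polynomials depending on a parameter *)

(** A barrier bound is kept as a cone membership: for F free of y_i and a with y_i = 0, the point a
    - c y_i lies in the cone of (1 + y_i D_i) F exactly when F - c D_i F has no zero at a + s 1 for
    s > 0; given positivity, D_i F / F < 1/c there. The relation c (del - 1) = del reads 1/c + 1/del
    = 1, the condition under which setting y_i to -1 and shifting the copies of x_i by del keeps the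
    other barriers at level 1/c. As c > 1, the operator applied last still stands at y = -c, better
    than the required -1; averaging spreads this surplus over all indices, and del is chosen to
    minimise the resulting bound.

    Two obstacles remain. Rank at most 1 gives affineness only on lines through multiples of 1, so
    growth has to be transported to other base points. And the barrier yields a suitable f only for
    each T beyond delta; delta itself is reached because there are finitely many f. Hyperbolicity
    and cones are expressed by nonvanishing, which a homotopy preserves, rather than by ordered
    zeros. *)

Local Notation CC := (RR[i]).
Local Notation rc := (real_complex RR).
Local Notation mag := (@Normc.normc RR).
Local Notation ii := ('i%C : CC).

Lemma magE (z : CC) : (mag z)%:C%C = `|z|.
Proof. by []. Qed.

Lemma mag_ge0 (z : CC) : 0 <= mag z.
Proof. by rewrite -ler0c magE normr_ge0. Qed.

Lemma mag_gt0 (z : CC) : (0 < mag z) = (z != 0).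
Proof.
rewrite lt_def mag_ge0 andbT; congr (~~ _); apply/eqP/eqP => [|->].
  exact: Normc.eq0_normc.
exact: Normc.normc0.
Qed.

Lemma mag_real (x : RR) : mag (x%:C)%C = `|x|.
Proof. by rewrite /= expr0n addr0 sqrtr_sqr. Qed.

Lemma magD (x y : CC) : mag (x + y) <= mag x + mag y.
Proof. by rewrite -lecR rmorphD /= !magE ler_normD. Qed.

Lemma magN (x : CC) : mag (- x) = mag x.
Proof. by apply: complexI; rewrite !magE normrN. Qed.

Lemma magB (x y : CC) : mag x - mag y <= mag (x - y).
Proof. have := magD (x - y) y; rewrite subrK; lra. Qed.

Lemma mag_Im (z : CC) : `|complex.Im z| <= mag z.
Proof.
case: z => a b /=; rewrite -(sqrtr_sqr b) ler_wsqrtr // lerDr.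
exact: sqr_ge0.
Qed.

(** The local equivalence says at once that [P] and its negation are open; the supremum of the
    initial segments on which [P] holds must then be 1. *)
Lemma unit_interval_connected (P : RR -> Prop) :
  P 0 ->
  (forall x, 0 <= x <= 1 -> exists2 d, 0 < d &
     forall y, 0 <= y <= 1 -> `|y - x| < d -> (P y <-> P x)) ->
  P 1.
Proof.
move=> P0 Ploc.
pose E x := 0 <= x <= 1 /\ forall y, 0 <= y <= x -> P y.
have [|//|s [ubs lubs]] := completeness E.
- by exists 1 => x [/andP[_ /RleP]].
- exists 0; split; first lra.
  by move=> y h; have -> : y = 0 by lra.
have s0 : 0 <= s.
  apply/RleP/ubs; split; first lra.
  by move=> y h; have -> : y = 0 by lra.
have s1 : s <= 1 by apply/RleP/lubs => x [/andP[_ /RleP]].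
have [|d d0 hd] := Ploc s; first lra.
have [x [Ex xs]] : exists x, E x /\ s - d < x.
  case: (Classical_Prop.classic (exists x, E x /\ s - d < x)) => // H.
  have : Rdefinitions.Rle s (s - d)%R.
    apply: lubs => x Ex; apply/RleP; rewrite leNgt; apply/negP => hx.
    by apply: H; exists x.
  by move/RleP; lra.
have xles : x <= s by apply/RleP/ubs.
case: Ex => x01 hx.
have Ps : P s by apply/(hd x); [lra | rewrite ltr_norml; lra | apply: hx; lra].
have Py y : 0 <= y <= 1 -> y < s + d -> P y.
  move=> y01 ys; have [yx|xy] := leP y x; first by apply: hx; lra.
  by apply/(hd y) => //; rewrite ltr_norml; lra.
have [h1|h1] := ltP 1 (s + d); first by apply: Py; lra.
have : Rdefinitions.Rle (s + d / 2)%R s.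
  apply: ubs; split; first lra.
  by move=> y h; apply: Py; lra.
by move/RleP; lra.
Qed.

(* The zero-free disc controls every factor of the polynomial. *)
Lemma zero_free_disc_bound (a : {poly CC}) (D : nat) (s0 s : CC) (c : RR) :
  (size a <= D.+1)%N -> 0 < c ->
  (forall z, mag (z - s0) < c -> a.[z] != 0) ->
  mag a.[s] <= (1 + mag (s - s0) / c) ^+ D * mag a.[s0].
Proof.
move=> sa c0 ha.
have a0 : a != 0.
  apply: contraNneq (ha s0 _) => [->|]; first by rewrite horner0.
  by rewrite subrr Normc.normc0.
have [rs ars] := closed_field_poly_normal a.
have lc0 : lead_coef a != 0 by rewrite lead_coef_eq0.
have srs : (size rs <= D)%N.
  by move: sa; rewrite ars size_scale // size_prod_XsubC ltnS.
set K := 1 + _.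
have K1 : 1 <= K by rewrite lerDl divr_ge0 ?mag_ge0 // ltW.
have hrs r : r \in rs -> c <= mag (r - s0).
  move=> rin; rewrite leNgt; apply/negP => /ha.
  by rewrite ars hornerZ horner_prod (big_rem r) //= hornerXsubC subrr mul0r
     mulr0 eqxx.
suff H : forall t : seq CC, {subset t <= rs} ->
   mag (\prod_(r <- t) (s - r)) <= K ^+ size t * mag (\prod_(r <- t) (s0 - r)).
  have aE x : a.[x] = lead_coef a * \prod_(r <- rs) (x - r).
    rewrite {1}ars hornerZ horner_prod; congr (_ * _).
    by apply: eq_bigr => r _; rewrite hornerXsubC.
  rewrite !aE !Normc.normcM mulrCA ler_wpM2l ?mag_ge0 //.
  apply: le_trans (H rs _) _ => //.
  by rewrite ler_wpM2r ?mag_ge0 // ler_weXn2l.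
elim=> [|r t IH] tin; first by rewrite !big_nil /= expr0 mul1r.
rewrite !big_cons !Normc.normcM exprS.
rewrite mulrACA ler_pM ?mag_ge0 //; last first.
  by apply: IH => x xt; apply: tin; rewrite inE xt orbT.
have cr : c <= mag (s0 - r).
  by rewrite -magN opprB; apply: hrs; apply: tin; rewrite inE eqxx.
have -> : s - r = (s - s0) + (s0 - r) by ring.
apply: le_trans (magD _ _) _.
rewrite /K mulrDl mul1r addrC lerD2l -mulrA ler_peMr ?mag_ge0 //.
by rewrite mulrC ler_pdivlMr // mul1r.
Qed.

Lemma horner_bounded_unit_disc (c : {poly CC}) :
  exists2 M : RR, 0 <= M & forall w, mag w <= 1 -> mag c.[w] <= M.
Proof.
elim/poly_ind: c => [|c k [M M0 IH]].
  by exists 0 => // w _; rewrite horner0 Normc.normc0.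
exists (M + mag k) => [|w w1]; first by rewrite addr_ge0 ?mag_ge0.
rewrite hornerMXaddC; apply: le_trans (magD _ _) _; rewrite lerD2r.
rewrite Normc.normcM -[leRHS]mulr1; apply: ler_pM; rewrite ?mag_ge0 //.
exact: IH.
Qed.

Lemma horner2_lipschitz (B : {poly {poly CC}}) :
  exists M L : RR, [/\ 0 <= M, 0 <= L &
    forall x y : RR, 0 <= x <= 1 -> 0 <= y <= 1 -> forall w, mag w <= 1 ->
    mag B.[(x%:C%C)%:P].[w] <= M /\
    mag (B.[(x%:C%C)%:P].[w] - B.[(y%:C%C)%:P].[w]) <= L * `|x - y|].
Proof.
elim/poly_ind: B => [|B c [M [L [M0 L0 IH]]]].
  exists 0, 0; split=> // x y _ _ w _.
  by rewrite !horner0 subrr Normc.normc0 mul0r lexx.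
have [K K0 hK] := horner_bounded_unit_disc c.
exists (M + K), (L + M); split; rewrite ?addr_ge0 // => x y hx hy w w1.
have [IHx IHL] := IH x y hx hy w w1.
have [IHy _] := IH y x hy hx w w1.
rewrite !hornerMXaddC !hornerD !hornerM !hornerC.
set bx := B.[_].[w] in IHx IHL *; set by_ := B.[_].[w] in IHy IHL *.
split.
  apply: le_trans (magD _ _) _; apply: lerD; last exact: hK.
  rewrite Normc.normcM mag_real -[leRHS]mulr1; apply: ler_pM;
    rewrite ?mag_ge0 ?normr_ge0 //.
  by rewrite ger0_norm; lra.
have -> : bx * x%:C%C + c.[w] - (by_ * y%:C%C + c.[w])
   = (bx - by_) * x%:C%C + by_ * (x - y)%:C%C.
  by rewrite rmorphB /=; ring.
apply: le_trans (magD _ _) _; rewrite !Normc.normcM !mag_real mulrDl.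
apply: lerD; last by apply: ler_wpM2r.
rewrite -[leRHS]mulr1; apply: ler_pM; rewrite ?mag_ge0 ?normr_ge0 //.
by rewrite ger0_norm; lra.
Qed.

Lemma horner2_size (B : {poly {poly CC}}) :
  exists D, forall x : CC, (size B.[x%:P]%R <= D.+1)%N.
Proof.
elim/poly_ind: B => [|B c [D IH]].
  by exists 0%N => x; rewrite horner0 size_poly0.
exists (maxn D (size c)) => x; rewrite hornerMXaddC mulrC mul_polyC.
apply: leq_trans (size_polyD _ _) _; rewrite geq_max; apply/andP; split.
  by apply: leq_trans (size_scale_leq _ _) _; apply: leq_trans (IH x) _;
    rewrite ltnS leq_maxl.
by rewrite ltnW // ltnS leq_maxr.
Qed.

Lemma horner_lower_bound_unit_disc (a : {poly CC}) :
  (forall w, mag w <= 1 -> a.[w] != 0) ->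
  exists2 mu : RR, 0 < mu & forall w, mag w <= 1 -> mu <= mag a.[w].
Proof.
move=> ha.
have a0 : a != 0.
  apply: contraNneq (ha 0 _) => [->|]; first by rewrite horner0.
  by rewrite Normc.normc0.
have [rs ars] := closed_field_poly_normal a.
have hrs r : r \in rs -> 1 < mag r.
  move=> rin; rewrite ltNge; apply/negP => /ha.
  by rewrite ars hornerZ horner_prod (big_rem r) //= hornerXsubC subrr mul0r
     mulr0 eqxx.
have lc0 : 0 < mag (lead_coef a) by rewrite mag_gt0 lead_coef_eq0.
suff [mu mu0 H] : exists2 mu : RR, 0 < mu &
    forall w, mag w <= 1 -> mu <= mag (\prod_(r <- rs) (w - r)).
  exists (mag (lead_coef a) * mu) => [|w w1]; first exact: mulr_gt0.
  rewrite ars hornerZ horner_prod Normc.normcM.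
  rewrite -ars ler_wpM2l ?mag_ge0 //; apply: le_trans (H w w1) _.
  by under [in leRHS]eq_bigr do rewrite hornerXsubC.
elim: rs hrs {ars} => [|r t IH] hrs.
  by exists 1 => // w _; rewrite big_nil Normc.normc1.
have [|mu mu0 H] := IH; first by move=> x xt; apply: hrs; rewrite inE xt orbT.
have r1 : 1 < mag r by apply: hrs; rewrite inE eqxx.
exists ((mag r - 1) * mu) => [|w w1]; first by rewrite mulr_gt0 ?subr_gt0.
rewrite big_cons Normc.normcM ler_pM ?subr_ge0 ?H ?(ltW mu0) ?(ltW r1) //.
by have := magB r w; rewrite -[mag (w - r)]magN opprB; lra.
Qed.

(* Zeros cannot cross the unit circle: having a zero in the open disc is both
   an open and a closed condition on the parameter. *)
Lemma unit_disc_homotopy (B : {poly {poly CC}}) :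
  (forall (x : RR) w, 0 <= x <= 1 -> mag w = 1 -> B.[(x%:C%C)%:P].[w] != 0) ->
  (forall w, mag w < 1 -> B.[0].[w] != 0) ->
  forall w, mag w < 1 -> B.[1].[w] != 0.
Proof.
move=> hbd h0.
have [M [L [M0 L0 hL]]] := horner2_lipschitz B.
have [D hD] := horner2_size B.
pose P (x : RR) := forall w, mag w < 1 -> B.[(x%:C%C)%:P].[w] != 0.
suff : P 1 by [].
apply: unit_interval_connected => [//|x hx].
case: (Classical_Prop.classic (P x)) => [Px|nPx].
  (* Openness of zero-freeness: the lower bound [mu] on the closed disc outweighs the Lipschitz
     variation in the parameter. *)
  have [|mu mu0 hmu] := @horner_lower_bound_unit_disc (B.[(x%:C%C)%:P]).
    by move=> w; rewrite le_eqVlt => /orP[/eqP/(hbd x w hx)//|/Px].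
  exists (mu / (L + 1)) => [|y hy hd]; first by rewrite divr_gt0 //; lra.
  split=> // _ w w1; rewrite -mag_gt0.
  have [_ h1] := hL x y hx hy w (ltW w1).
  have h2 := hmu w (ltW w1).
  have := magB (B.[(x%:C%C)%:P].[w]) (B.[(x%:C%C)%:P].[w] - B.[(y%:C%C)%:P].[w]).
  rewrite opprB addrCA subrr addr0.
  move: hd; rewrite ltr_pdivlMr; last lra.
  rewrite distrC => hd.
  have h3 : 0 <= `|x - y| by [].
  have : L * `|x - y| < mu by nra.
  lra.
(* Openness of having a zero: if [B] at y were zero-free, the disc of radius 1 - |w0| about [w0]
   would bound |B(y, 1)| by K |B(y, w0)|, which is of order |y - x|, whereas B(x, 1) != 0. *)
have [w0 [w01 /eqP r0]] : exists w0, mag w0 < 1 /\ B.[(x%:C%C)%:P].[w0] == 0.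
  apply: Classical_Prop.NNPP => H; apply: nPx => w w1; apply/eqP => h.
  by apply: H; exists w; rewrite h.
set c := 1 - mag w0.
have c0 : 0 < c by rewrite /c; lra.
pose K := (1 + mag (1 - w0) / c) ^+ D.
have K0 : 0 <= K.
  by apply: exprn_ge0; rewrite addr_ge0 // divr_ge0 ?mag_ge0 ?ltW.
set be := mag (B.[(x%:C%C)%:P].[1]).
have be0 : 0 < be by rewrite mag_gt0 hbd ?Normc.normc1.
have KL : 0 <= (K + 1) * L by rewrite mulr_ge0 ?addr_ge0.
exists (be / ((K + 1) * L + 1)) => [|y hy hd]; first by rewrite divr_gt0; lra.
split=> // Py; exfalso.
have h1 : mag B.[(y%:C%C)%:P].[1] <= K * mag B.[(y%:C%C)%:P].[w0].
  apply: zero_free_disc_bound => // z hz; apply: Py.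
  have := magD (z - w0) w0; rewrite subrK /c in hz *; lra.
have [_] := hL y x hy hx w0 (ltW w01); rewrite r0 subr0 => h2.
have [|_ h3] := hL x y hx hy 1 _; first by rewrite Normc.normc1.
have := magB (B.[(x%:C%C)%:P].[1]) (B.[(x%:C%C)%:P].[1] - B.[(y%:C%C)%:P].[1]).
rewrite opprB addrCA subrr addr0 -/be => h4.
move: hd; rewrite ltr_pdivlMr; last lra.
rewrite distrC in h3 * => h5.
have h6 : K * mag B.[(y%:C%C)%:P].[w0] <= K * (L * `|y - x|) by apply: ler_wpM2l.
have h7 : 0 <= `|y - x| by [].
nra.
Qed.

(** * Garding's theorem *)

Lemma mag_sqr (z : CC) : mag z ^+ 2 = complex.Re z ^+ 2 + complex.Im z ^+ 2.
Proof. by case: z => a b /=; rewrite sqr_sqrtr // addr_ge0 ?sqr_ge0. Qed.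

Lemma lt_mag_Im (s : CC) : 0 < complex.Im s -> mag (s - ii) < mag (s + ii).
Proof.
move=> s0; rewrite -(ltr_pXn2r (n := 2)) ?nnegrE ?mag_ge0 // !mag_sqr.
by case: s s0 => a b /= b0; nra.
Qed.

Lemma Im_moebius (w s : CC) : (1 - w) * s = ii * (1 + w) ->
  complex.Im s * mag (1 - w) ^+ 2 = 1 - mag w ^+ 2.
Proof.
rewrite !mag_sqr; case: s => x y; case: w => a b /= [h1 h2].
have {}h1 : (1 - a) * x + b * y = - b by lra.
have {}h2 : (1 - a) * y - b * x = 1 + a by lra.
have -> : y * ((1 - a) ^+ 2 + (0 - b) ^+ 2) =
  (1 - a) * ((1 - a) * y - b * x) + b * ((1 - a) * x + b * y) by ring.
by rewrite h1 h2; ring.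
Qed.

Definition cM a b (X : 'M[RR]_(a, b)) : 'M[CC]_(a, b) := map_mx rc X.

Lemma cMD a b (X Y : 'M[RR]_(a, b)) : cM (X + Y) = cM X + cM Y.
Proof. exact: map_mxD. Qed.

Lemma cMN a b (X : 'M[RR]_(a, b)) : cM (- X) = - cM X.
Proof. exact: map_mxN. Qed.

Lemma cMZ a b x (X : 'M[RR]_(a, b)) : cM (x *: X) = (x%:C)%C *: cM X.
Proof. exact: map_mxZ. Qed.

Lemma cM0 a b : cM (0 : 'M[RR]_(a, b)) = 0.
Proof. exact: map_mx0. Qed.

Local Ltac mxring := apply/matrixP => ? ?; rewrite /cM !mxE; ring.
Local Ltac mxfield := apply/matrixP => ? ?; rewrite /cM !mxE; field.

(* Polynomiality, tested on the parametrized surfaces that a Moebius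
   reparametrization of the segment homotopy needs. *)
Definition bipoly a b (F : 'M[CC]_(a, b) -> CC) :=
  forall v0 v1 v2 v3, exists B : {poly {poly CC}}, forall s t : CC,
    F (v0 + s *: v1 + t *: v2 + (s * t) *: v3) = B.[t%:P].[s].

Definition homf a b (d : nat) (F : 'M[CC]_(a, b) -> CC) :=
  forall (c : CC) v, c != 0 -> F (c *: v) = c ^+ d * F v.

Lemma homf_neq0 a b d (F : 'M[CC]_(a, b) -> CC) c v :
  homf d F -> c != 0 -> (F (c *: v) != 0) = (F v != 0).
Proof. by move=> hF c0; rewrite hF // mulf_eq0 expf_eq0 (negPf c0) andbF. Qed.

(** The map s = i (1 + w) / (1 - w) carries the unit disc to the upper half-plane and the circle to
    the real line with w = 1 at infinity. The hypothesis [F ga != 0] is the boundary condition at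
    that point. *)
Lemma half_plane_homotopy a b (F : 'M[CC]_(a, b) -> CC) d (al be ga : 'M[CC]_(a, b)) :
  bipoly F -> homf d F -> F ga != 0 ->
  (forall x s : RR, 0 <= x <= 1 ->
     F (al + (x%:C)%C *: be + (s%:C)%C *: ga) != 0) ->
  (forall s : CC, 0 < complex.Im s -> F (al + s *: ga) != 0) ->
  forall s : CC, 0 < complex.Im s -> F (al + be + s *: ga) != 0.
Proof.
move=> bF hF ga0 hreal h0 s s0.
(* Multiplying the argument by 1 - w clears the denominator and leaves a surface bilinear in w and
   the homotopy parameter. *)
have [B hB] := bF (al + ii *: ga) (- al + ii *: ga) be (- be).
have BE (x w : CC) :
    B.[x%:P].[w] = F ((1 - w) *: (al + x *: be) + (ii * (1 + w)) *: ga).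
  by rewrite -hB; congr F; mxring.
have ii0 : ii != 0 by rewrite -mag_gt0 /= expr0n expr1n add0r sqrtr1.
have BE1 (x w : CC) : w != 1 ->
    let s := ii * (1 + w) / (1 - w) in
    B.[x%:P].[w] = (1 - w) ^+ d * F (al + x *: be + s *: ga).
  move=> w1 /=; have w10 : 1 - w != 0 by rewrite subr_eq0 eq_sym.
  by rewrite BE -hF //; congr F; mxfield.
have nz (x w : CC) : w != 1 ->
    F (al + x *: be + (ii * (1 + w) / (1 - w)) *: ga) != 0 ->
    B.[x%:P].[w] != 0.
  move=> w1 h; rewrite BE1 // mulf_neq0 // expf_neq0 //.
  by rewrite subr_eq0 eq_sym.
have Ims (w : CC) : w != 1 ->
    complex.Im (ii * (1 + w) / (1 - w)) * mag (1 - w) ^+ 2 = 1 - mag w ^+ 2.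
  move=> w1; apply: Im_moebius; rewrite mulrC divfK //.
  by rewrite subr_eq0 eq_sym.
have mag1 (w : CC) : w != 1 -> 0 < mag (1 - w) ^+ 2.
  by move=> w1; rewrite exprn_gt0 // mag_gt0 subr_eq0 eq_sym.
have H := @unit_disc_homotopy B _ _.
have si0 : s + ii != 0.
  by apply: contraTneq (lt_mag_Im s0) => ->; rewrite Normc.normc0 -leNgt mag_ge0.
set w := (s - ii) / (s + ii).
have w1 : mag w < 1.
  rewrite /w Normc.normcM Normc.normcV ltr_pdivrMr ?mag_gt0 // mul1r.
  exact: lt_mag_Im.
have wn1 : w != 1 by apply: contraTneq w1 => ->; rewrite Normc.normc1 ltxx.
have -> : al + be + s *: ga =
    al + 1 *: be + (ii * (1 + w) / (1 - w)) *: ga.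
  rewrite scale1r; congr (_ + _ *: _).
  have two : (1 - w) = 2 * ii / (s + ii) by rewrite /w; field.
  rewrite two /w; field; rewrite ?si0 ?ii0 //=.
suff : B.[1].[w] != 0.
  by rewrite -polyC1 BE1 // mulf_eq0 negb_or => /andP[].
move: w w1 {wn1} => w'; move: w' {s s0 si0}.
apply: H => [x w hx w1|w w1].
  have [->|wn1] := eqVneq w 1.
    by rewrite BE subrr scale0r add0r (homf_neq0 _ hF) // mulf_neq0 // -[1 + 1]/2
      pnatr_eq0.
  apply: nz => //; set s := (_ / _ : CC).
  suff -> : s = (complex.Re s)%:C%C by apply: hreal.
  have := Ims w wn1; rewrite w1 expr1n subrr => /eqP.
  rewrite mulf_eq0 (gt_eqF (mag1 w wn1)) orbF -/s.
  by case: (s) => u v /= /eqP ->.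
have wn1 : w != 1 by apply: contraTneq w1 => ->; rewrite Normc.normc1 ltxx.
rewrite -polyC0 nz // scale0r addr0; apply: h0.
have := Ims w wn1; set y := complex.Im _ => h.
by rewrite -(pmulr_lgt0 _ (mag1 w wn1)) h subr_gt0 expr_lt1 ?mag_ge0.
Qed.

(** For homogeneous F this amounts to F(e) != 0 together with real-rootedness of t -> F(t e - X): a
    nonreal zero can be translated and rescaled to i. *)
Definition hyp_dir a b (F : 'M[CC]_(a, b) -> CC) (e : 'M[RR]_(a, b)) :=
  forall X : 'M[RR]_(a, b), F (cM X + ii *: cM e) != 0.

(** The closed hyperbolicity cone: a positive zero of t -> F(v + t e) would be minus a negative
    eigenvalue. *)
Definition cone a b (F : 'M[CC]_(a, b) -> CC) (e v : 'M[RR]_(a, b)) :=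
  forall t : RR, 0 < t -> F (cM (v + t *: e)) != 0.

Lemma rc_neq0 (x : RR) : ((x%:C)%C != 0 :> CC) = (x != 0).
Proof. by rewrite fmorph_eq0. Qed.

Lemma ii_neq0 : ii != 0.
Proof. by rewrite -mag_gt0 /= expr0n expr1n add0r sqrtr1. Qed.

Section Garding.
Variables (a b d : nat) (F : 'M[CC]_(a, b) -> CC) (e : 'M[RR]_(a, b)).
Hypotheses (bF : bipoly F) (hF : homf d F) (he : hyp_dir F e).

Lemma hyp_dirZ e' (c : RR) : hyp_dir F e' -> c != 0 -> hyp_dir F (c *: e').
Proof.
move=> he' c0 X; have := he' (c^-1 *: X).
rewrite -(homf_neq0 _ hF (c := (c%:C)%C)) ?rc_neq0 // scalerDr !cMZ scalerA.
rewrite -rmorphM mulfV // rmorph1 scale1r !scalerA.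
by rewrite mulrC.
Qed.

Lemma hyp_dir_neq0 e' : hyp_dir F e' -> F (cM e') != 0.
Proof. by move/(_ 0); rewrite cM0 add0r (homf_neq0 _ hF) ?ii_neq0. Qed.

(** For nonreal c, division by c turns the argument into a real vector plus a nonzero imaginary
    multiple of [e']; for real c it is the second hypothesis. *)
Lemma hyp_dir_complex e' v (c : CC) : hyp_dir F e' ->
  (forall r : RR, 0 < r -> F (cM (e' + r *: v)) != 0) ->
  0 < complex.Re c -> F (cM e' + c *: cM v) != 0.
Proof.
move=> he' hv c0; have [Im0|Im0] := eqVneq (complex.Im c) 0.
  have -> : c = (complex.Re c)%:C%C by case: (c) Im0 => x y /= ->.
  by rewrite -cMZ -cMD hv.
have cn0 : c != 0 by apply: contraNneq Im0 => ->.
rewrite -(homf_neq0 _ hF (c := c^-1)) ?invr_eq0 // scalerDr scalerA mulVf //.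
rewrite scale1r.
have Imc : complex.Im c^-1 != 0.
  apply: contraNneq Im0 => h.
  have -> : c = (complex.Re c^-1)^-1%:C%C.
    by rewrite -[LHS]invrK fmorphV; congr (_^-1); case: (c^-1) h => x y /= ->.
  by [].
have := hyp_dirZ he' Imc (v + complex.Re c^-1 *: e').
congr (is_true (F _ != 0)); rewrite [in RHS](complexE c^-1).
move: (complex.Re _) (complex.Im _) => x y; mxring.
Qed.

Lemma coneZ v (c : RR) : cone F e v -> 0 <= c -> cone F e (c *: v).
Proof.
move=> hv; rewrite le_eqVlt => /orP[/eqP <- t t0|c0 t t0].
  rewrite scale0r add0r; apply: hyp_dir_neq0; apply: hyp_dirZ => //.
  exact: lt0r_neq0.
have ct0 : 0 < c^-1 * t by rewrite mulr_gt0 ?invr_gt0.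
have := hv _ ct0.
rewrite -(homf_neq0 (cM (v + (c^-1 * t) *: e)) hF (c := (c%:C)%C)); last first.
  by rewrite rc_neq0 lt0r_neq0.
suff -> : (c%:C)%C *: cM (v + (c^-1 * t) *: e) = cM (c *: v + t *: e) by [].
by mxfield; rewrite ?rc_neq0 lt0r_neq0.
Qed.

Lemma cone_hyp_dir v (t : RR) : cone F e v -> 0 < t -> hyp_dir F (v + t *: e).
Proof.
move=> hv t0 X; have t20 : 0 < t / 2 by lra.
have he2 : hyp_dir F ((t / 2) *: e) by apply: hyp_dirZ; rewrite ?lt0r_neq0.
pose v' := v + (t / 2) *: e.
(* At s = i the endpoint is X + i (v + t e). Half of t stays in i (t/2) e, which prevents zeros for
   real s; the other half puts [v'] inside the cone. *)
have := @half_plane_homotopy _ _ F d (ii *: cM ((t / 2) *: e)) (cM X) (cM v')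
   bF hF (hv _ t20) _ _ ii _.
have -> : cM X + ii *: cM (v + t *: e) =
   ii *: cM ((t / 2) *: e) + cM X + ii *: cM v'.
  by rewrite /v'; mxfield.
apply=> [x s hx|s s0|]; last by rewrite /= ltr01.
  rewrite -addrA addrC -!cMZ -cMD; exact: he2.
rewrite -(homf_neq0 _ hF (c := ii^-1)) ?invr_eq0 ?ii_neq0 // scalerDr !scalerA.
rewrite mulVf ?ii_neq0 // scale1r; apply: hyp_dir_complex => // [r r0|].
  have -> : (t / 2) *: e + r *: v' = r *: v + ((1 + r) * (t / 2)) *: e.
    by rewrite /v'; mxring.
  by apply: coneZ => //; [exact: ltW | rewrite mulr_gt0 // addr_gt0].
by case: s s0 => x y /=; rewrite expr0n expr1n add0r !divr1; lra.
Qed.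

Lemma coneD v1 v2 : cone F e v1 -> cone F e v2 -> cone F e (v1 + v2).
Proof.
move=> h1 h2 t t0; have t20 : 0 < t / 2 by lra.
pose e2 := (t / 2) *: e; pose v1' := v1 + e2.
have he2 : hyp_dir F e2 by apply: hyp_dirZ; rewrite ?lt0r_neq0.
have hv1' : hyp_dir F v1' by exact: cone_hyp_dir.
(* The direction is turned by -i so that s = i gives the real vector e2 + v2 + v1'. For real s != 0
   its term is purely imaginary and [v1'] is a hyperbolicity direction; at s = 0 only the cone
   membership of [v2] is used. *)
have := @half_plane_homotopy _ _ F d (cM e2) (cM v2) (- ii *: cM v1')
   bF hF _ _ _ ii _.
have -> : cM (v1 + v2 + t *: e) = cM e2 + cM v2 + ii *: (- ii *: cM v1').
  rewrite scalerA mulrN -expr2 sqr_i opprK scale1r -!cMD; congr cM.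
  by rewrite /v1' /e2; mxfield.
apply=> [|x s hx|s s0|]; last by rewrite /= ltr01.
- by rewrite (homf_neq0 _ hF) ?oppr_eq0 ?ii_neq0 // hyp_dir_neq0.
- have [->|s0] := eqVneq s 0.
    rewrite rmorph0 scale0r addr0 -cMZ -cMD addrC; apply: coneZ => //.
    by case/andP: hx.
  have -> : (s%:C)%C *: (- ii *: cM v1') = ii *: cM (- s *: v1').
    by mxring.
  by rewrite -cMZ -cMD; apply: hyp_dirZ; rewrite ?oppr_eq0.
rewrite scalerA; apply: hyp_dir_complex => // [r r0|].
  have -> : e2 + r *: v1' = r *: v1 + ((1 + r) * (t / 2)) *: e.
    by rewrite /v1' /e2; mxring.
  apply: coneZ => //; first exact: ltW.
  by rewrite mulr_gt0 // addr_gt0.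
by case: s s0 => x y /=; lra.
Qed.

Lemma cone0 : cone F e 0.
Proof. by rewrite -[0](scale0r e); apply: coneZ => // t t0;
  rewrite -{1}[e]scale1r -scalerDl; apply: hyp_dir_neq0; apply: hyp_dirZ => //;
  rewrite lt0r_neq0 // addr_gt0. Qed.

Lemma cone_sum (I : Type) (r : seq I) (P : pred I) (v : I -> 'M[RR]_(a, b)) :
  (forall i, P i -> cone F e (v i)) -> cone F e (\sum_(i <- r | P i) v i).
Proof. by move=> h; apply: (big_ind (cone F e)) => //; [exact: cone0 | exact: coneD]. Qed.

End Garding.

(** * Polynomials on matrix spaces *)

Lemma bipoly_ext a b (F G : 'M[CC]_(a, b) -> CC) : F =1 G -> bipoly F -> bipoly G.
Proof.
by move=> FG bF v0 v1 v2 v3; have [B hB] := bF v0 v1 v2 v3; exists B => s t;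
  rewrite -FG.
Qed.

Lemma bipoly_const a b (c : CC) : bipoly (fun _ : 'M[CC]_(a, b) => c).
Proof. by move=> *; exists c%:P%:P => s t; rewrite !hornerC. Qed.

Lemma bipoly_entry a b i j : bipoly (fun z : 'M[CC]_(a, b) => z i j).
Proof.
move=> v0 v1 v2 v3.
exists ((v0 i j)%:P%:P + 'X%:P * (v1 i j)%:P%:P + 'X * (v2 i j)%:P%:P
        + 'X%:P * 'X * (v3 i j)%:P%:P) => s t.
by rewrite !mxE !(hornerE, hornerM).
Qed.

Lemma bipolyD a b (F G : 'M[CC]_(a, b) -> CC) :
  bipoly F -> bipoly G -> bipoly (fun z => F z + G z).
Proof.
move=> bF bG v0 v1 v2 v3; have [B hB] := bF v0 v1 v2 v3.
by have [B' hB'] := bG v0 v1 v2 v3; exists (B + B') => s t; rewrite hB hB' !hornerD.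
Qed.

Lemma bipolyM a b (F G : 'M[CC]_(a, b) -> CC) :
  bipoly F -> bipoly G -> bipoly (fun z => F z * G z).
Proof.
move=> bF bG v0 v1 v2 v3; have [B hB] := bF v0 v1 v2 v3.
by have [B' hB'] := bG v0 v1 v2 v3; exists (B * B') => s t; rewrite hB hB' !hornerM.
Qed.

Lemma bipolyN a b (F : 'M[CC]_(a, b) -> CC) : bipoly F -> bipoly (fun z => - F z).
Proof.
move=> bF; apply: (bipoly_ext (F := fun z => -1 * F z)) => [z|].
  by rewrite mulN1r.
by apply: bipolyM => //; apply: bipoly_const.
Qed.

Lemma bipolyX a b (F : 'M[CC]_(a, b) -> CC) n :
  bipoly F -> bipoly (fun z => F z ^+ n).
Proof.
move=> bF; elim: n => [|n IH]; first exact: bipoly_const.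
apply: (bipoly_ext (F := fun z => F z * F z ^+ n)) => [z|]; first by rewrite exprS.
exact: bipolyM.
Qed.

Lemma bipoly_sum a b (I : Type) (r : seq I) (F : I -> 'M[CC]_(a, b) -> CC) :
  (forall i, bipoly (F i)) -> bipoly (fun z => \sum_(i <- r) F i z).
Proof.
move=> bF; elim: r => [|i r IH].
  by apply: (bipoly_ext (F := fun=> 0)) => [z|]; [rewrite big_nil | exact: bipoly_const].
apply: (bipoly_ext (F := fun z => F i z + _)) (bipolyD (bF i) IH) => z.
by rewrite big_cons.
Qed.

Lemma bipoly_prod a b (I : Type) (r : seq I) (F : I -> 'M[CC]_(a, b) -> CC) :
  (forall i, bipoly (F i)) -> bipoly (fun z => \prod_(i <- r) F i z).
Proof.
move=> bF; elim: r => [|i r IH].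
  by apply: (bipoly_ext (F := fun=> 1)) => [z|]; [rewrite big_nil | exact: bipoly_const].
apply: (bipoly_ext (F := fun z => F i z * _)) (bipolyM (bF i) IH) => z.
by rewrite big_cons.
Qed.

Lemma bipoly_linear a b a' b' (F : 'M[CC]_(a, b) -> CC)
    (L : {linear 'M[CC]_(a', b') -> 'M[CC]_(a, b)}) :
  bipoly F -> bipoly (fun z => F (L z)).
Proof.
move=> bF v0 v1 v2 v3; have [B hB] := bF (L v0) (L v1) (L v2) (L v3).
by exists B => s t; rewrite -hB !linearD !linearZ.
Qed.

Lemma bipoly_shift a b (F : 'M[CC]_(a, b) -> CC) c :
  bipoly F -> bipoly (fun z => F (z + c)).
Proof.
move=> bF v0 v1 v2 v3; have [B hB] := bF (v0 + c) v1 v2 v3.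
by exists B => s t; rewrite -hB; congr F; mxring.
Qed.

Lemma bipoly_line a b (F : 'M[CC]_(a, b) -> CC) z v : bipoly F ->
  exists P : {poly CC}, forall s, F (z + s *: v) = P.[s].
Proof.
move=> bF; have [B hB] := bF z v 0 0; exists B.[0] => s.
by rewrite -polyC0 -hB !scaler0 !addr0.
Qed.

(** With K = 0 this also serves as the identity principle for polynomials vanishing on the reals
    beyond 1. *)
Lemma poly_eq0_growth (Q : {poly CC}) (K : RR) :
  (forall t : RR, 1 <= t -> t * mag Q.[(t%:C)%C] <= K) -> Q = 0.
Proof.
elim/poly_ind: Q K => [//|Q c IH] K hK.
have Q0 : Q = 0.
  apply: (IH (K + mag c)) => t t1.
  have := hK t t1; rewrite hornerMXaddC => h.
  have := magB (Q.[(t%:C)%C] * (t%:C)%C) (- c).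
  rewrite opprK magN Normc.normcM mag_real ger0_norm; last lra.
  have := mag_ge0 c; have := mag_ge0 (Q.[(t%:C)%C] * t%:C%C + c).
  have := mag_ge0 Q.[(t%:C)%C].
  by move: (mag _) (mag _) (mag _) h => x y z; nra.
rewrite Q0 mul0r add0r; case: (eqVneq c 0) => [->//|c0].
have mc : 0 < mag c by rewrite mag_gt0.
have K0 : 0 <= K.
  by apply: le_trans (hK 1 (lexx _)); rewrite mul1r mag_ge0.
have t1 : 1 <= K / mag c + 1 by rewrite lerDr divr_ge0 // ltW.
have := hK _ t1; rewrite Q0 mul0r add0r hornerC mulrDl mul1r divfK ?lt0r_neq0 //.
by rewrite gerDl leNgt mc.
Qed.

Lemma poly_affine_growth (Q : {poly CC}) (K : RR) :
  (forall t : RR, 1 <= t -> mag Q.[(t%:C)%C] <= K * t) ->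
  exists A B : CC, forall s, Q.[s] = A + s * B.
Proof.
elim/poly_ind: Q => [|Q c _]; first by exists 0, 0 => s; rewrite horner0 mulr0 addr0.
elim/poly_ind: Q => [|Q c1 _] hK.
  by exists c, 0 => s; rewrite mul0r add0r hornerC mulr0 addr0.
suff -> : Q = 0.
  by exists c, c1 => s; rewrite mul0r add0r hornerMXaddC hornerC addrC mulrC.
apply: (@poly_eq0_growth _ (K + mag c1 + mag c)) => t t1.
have := hK t t1; rewrite !hornerMXaddC => h.
have := magB (Q.[t%:C%C] * t%:C%C * t%:C%C) (- c1 * t%:C%C - c).
have -> : Q.[t%:C%C] * t%:C%C * t%:C%C - (- c1 * t%:C%C - c) =
  (Q.[t%:C%C] * t%:C%C + c1) * t%:C%C + c by ring.
have := magD (- c1 * t%:C%C) (- c).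
rewrite !Normc.normcM !magN mag_real ger0_norm; last lra.
have := mag_ge0 c.
set x := mag Q.[_]; set y := mag c1; set z := mag c.
set u := mag (_ - c); set w := mag (_ + c) in h * => hz hu hw.
have zt : z <= z * t by rewrite ler_peMr.
have : t * (t * x) <= t * (K + y + z).
  by rewrite !mulrDr [t * K]mulrC [t * y]mulrC [t * z]mulrC [t * x]mulrC mulrC; lra.
by rewrite ler_pM2l //; lra.
Qed.

(* Growth of [F] along a real coordinate direction is, up to a constant, the
   same at every base point, because the zero-free polydisc around [i 1] does
   not shrink when a coordinate is pushed to the right. *)
Lemma affine_transfer m (F : 'rV[CC]_m -> CC) (i : 'I_m) :
  bipoly F ->
  (forall z : 'rV[CC]_m, (forall j, 0 < complex.Im (z 0 j)) -> F z != 0) ->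
  (exists A B : CC, forall s, F (const_mx ii + s *: delta_mx 0 i) = A + s * B) ->
  forall z s, F (z + s *: delta_mx 0 i) =
              F z + s * (F (z + delta_mx 0 i) - F z).
Proof.
move=> bF sF [A [B hAB]] z.
have [P hP] := bipoly_line z (delta_mx 0 i) bF.
suff [A' [B' h]] : exists A' B' : CC, forall s, P.[s] = A' + s * B'.
  move=> s; have -> : F (z + s *: delta_mx 0 i) = A' + s * B' by rewrite hP h.
  have -> : F (z + delta_mx 0 i) = A' + B'.
    by rewrite -[delta_mx 0 i]scale1r hP h mul1r.
  have -> : F z = A'.
    by rewrite -[z]addr0 -(scale0r (delta_mx 0 i)) hP h mul0r addr0.
  by ring.
have [z0 z0E] : exists z0 : 'rV[CC]_m, z0 = const_mx ii by exists (const_mx ii).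
rewrite -z0E in hAB.
have [Q hQ] := bF z0 (z - z0) (delta_mx 0 i) 0.
have [D hD] := horner2_size Q.
(* For |w| < c each coordinate of z0 + w (z - z0) moves by less than 1 and stays in the upper
   half-plane. The real shift by t leaves imaginary parts alone, so one constant [K] serves all
   t. *)
pose c := (1 + \sum_j mag ((z - z0) 0 j))^-1.
have S0 : 0 <= \sum_j mag ((z - z0) 0 j) by apply: sumr_ge0 => j _; apply: mag_ge0.
have c0 : 0 < c by rewrite invr_gt0 ltr_pwDl.
pose K := (1 + mag (1 - 0) / c) ^+ D.
have K0 : 0 <= K by rewrite exprn_ge0 // addr_ge0 // divr_ge0 ?mag_ge0 // ltW.
have := @poly_affine_growth P (K * (mag A + mag B)); apply=> t t1.
have -> : P.[t%:C%C] = Q.[(t%:C)%C%:P].[1].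
  by rewrite -hQ -hP scaler0 addr0 scale1r; congr F; mxring.
apply: le_trans (@zero_free_disc_bound Q.[(t%:C)%C%:P] D 0 1 c (hD _) c0 _) _.
  move=> w; rewrite subr0 => wc; rewrite -hQ; apply: sF => j.
  rewrite scaler0 addr0 !mxE z0E !mxE eqxx /=.
  have := mag_Im (w * (z 0 j - ii)); rewrite Normc.normcM.
  have h : mag w * mag ((z - z0) 0 j) < 1.
    have [->|zj] := eqVneq ((z - z0) 0 j) 0.
      by rewrite Normc.normc0 mulr0.
    have hj : mag ((z - z0) 0 j) <= \sum_j mag ((z - z0) 0 j).
      rewrite (bigD1 j) //= lerDl; apply: sumr_ge0 => *; exact: mag_ge0.
    apply: le_lt_trans (_ : mag w * (\sum_j mag ((z - z0) 0 j)) < _).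
      by rewrite ler_wpM2l ?mag_ge0.
    have : mag w * (1 + \sum_j mag ((z - z0) 0 j)) < 1.
      by rewrite -ltr_pdivlMr ?mul1r // ltr_pwDl.
    by rewrite mulrDr mulr1; apply: le_lt_trans; rewrite lerDr mag_ge0.
  rewrite z0E !mxE in h => h'.
  have : `|complex.Im (w * (z 0 j - ii))| < 1 by exact: le_lt_trans h' h.
  rewrite ltr_norml => /andP[h1 _].
  case: (w * (z 0 j - 'i%C)) h1 => x y /= h1.
  by case: (j == i); rewrite ?mulr1 ?mulr0 /=; clear -h1 t1; lra.
rewrite -/K -hQ scale0r scaler0 !addr0 hAB -!mulrA ler_wpM2l //.
apply: le_trans (magD _ _) _; rewrite Normc.normcM mag_real ger0_norm; last by clear -t1; lra.
by rewrite mulrDl [t * _]mulrC lerD2r ler_peMr ?mag_ge0.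
Qed.

(** * Wronskians *)

Lemma poly_ge0_at0 (G : {poly RR}) :
  (forall x : RR, 0 < x -> x <= 1 -> 0 <= G.[x]) -> 0 <= G.[0].
Proof.
move=> hG; rewrite leNgt; apply/negP => G0.
have [|d d0 hd] := @poly_cont _ 0 G (- G.[0]); first by rewrite oppr_gt0.
pose x := Num.min (d / 2) 1.
have x0 : 0 < x by rewrite /x lt_min ltr01 andbT divr_gt0.
have x1 : x <= 1 by rewrite /x ge_min lexx orbT.
have xd : x < d by rewrite /x gt_min ltr_pdivrMr // mulr_natr mulr2n ltrDl d0.
have := hd x; rewrite subr0 ger0_norm ?(ltW x0) // => /(_ xd).
by rewrite ltr_norml => /andP[_]; have := hG x x0 x1; lra.
Qed.

Lemma poly_vertical (P : {poly RR}) (x : RR) : exists U V : {poly RR},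
  forall t : RR, (map_poly rc P).[(x +i* t)%C] =
    ((P.[x] + t ^+ 2 * U.[t]) +i* (t * (P^`().[x] + t * V.[t])))%C.
Proof.
elim/poly_ind: P => [|P c [U [V IH]]].
  exists 0, 0 => t; rewrite rmorph0 deriv0 !horner0 !mulr0 !addr0 mulr0.
  by [].
exists (U * x%:P - (P^`().[x])%:P - 'X * V), (V * x%:P + 'X * U) => t.
have -> : map_poly rc (P * 'X + c%:P) = map_poly rc P * 'X + (rc c)%:P.
  by rewrite rmorphD rmorphM /= map_polyX map_polyC.
rewrite hornerMXaddC IH.
rewrite derivD derivM derivX derivC addr0 mulr1.
rewrite !hornerE /=; apply/eqP; rewrite eq_complex /=.
by apply/andP; split; apply/eqP; ring.
Qed.

Lemma Im_div (x y x' y' : RR) :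
  complex.Im ((x' +i* y')%C / (x +i* y)%C) = (y' * x - x' * y) / (x ^+ 2 + y ^+ 2).
Proof. by rewrite [LHS]/=; ring. Qed.

(* The first-order term of Im (q / r) at x + i t as t tends to 0. *)
Lemma wronskian_le0 (q r : {poly RR}) :
  (forall z : CC, 0 < complex.Im z -> (map_poly rc r).[z] != 0 /\
     complex.Im ((map_poly rc q).[z] / (map_poly rc r).[z]) <= 0) ->
  forall x, q^`().[x] * r.[x] - q.[x] * r^`().[x] <= 0.
Proof.
move=> H x.
have [U [V hr]] := poly_vertical r x.
have [U' [V' hq]] := poly_vertical q x.
pose G := ((q.[x])%:P + 'X ^+ 2 * U') * ((r^`().[x])%:P + 'X * V)
        - ((q^`().[x])%:P + 'X * V') * ((r.[x])%:P + 'X ^+ 2 * U).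
have GE t : G.[t] =
    (q.[x] + t ^+ 2 * U'.[t]) * (r^`().[x] + t * V.[t])
    - (q^`().[x] + t * V'.[t]) * (r.[x] + t ^+ 2 * U.[t]).
  by rewrite /G !hornerE.
suff : 0 <= G.[0] by rewrite GE; lra.
apply: poly_ge0_at0 => t t0 _.
have [] := H (x +i* t)%C t0.
rewrite hr hq Im_div {}GE.
move: (r.[x] + _) (r^`().[x] + _) (q.[x] + _) (q^`().[x] + _) => A B A' B'.
have hAB : ((A +i* (t * B))%C != 0 :> CC) -> 0 < A ^+ 2 + (t * B) ^+ 2.
  rewrite eq_complex /= negb_and => /orP[] h.
    by rewrite ltr_pwDl ?sqr_ge0 // exprn_even_gt0.
  by rewrite ltr_pwDr ?sqr_ge0 // exprn_even_gt0.
move=> /hAB {}hAB; rewrite pmulr_lle0 ?invr_gt0 // => h.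
have {}h : t * (B' * A - A' * B) <= 0 by lra.
by move: h; rewrite pmulr_rle0 // => h; lra.
Qed.

Lemma horner_derivable (P : {poly RR}) x :
  derivable_pt_lim (fun t => P.[t]) x (P^`().[x]).
Proof.
elim/poly_ind: P => [|P c IH].
  rewrite deriv0 horner0.
  apply: (derivable_pt_lim_ext (fun=> 0)) => [t|]; first by rewrite horner0.
  exact: derivable_pt_lim_const.
apply: (derivable_pt_lim_ext (fun t => Rdefinitions.Rplus
   (Rdefinitions.Rmult P.[t] t) c)) => [t|].
  by rewrite hornerMXaddC.
have -> : (P * 'X + c%:P)^`().[x] = Rdefinitions.Rplus
   (Rdefinitions.Rplus (Rdefinitions.Rmult P^`().[x] x)
       (Rdefinitions.Rmult P.[x] (Rdefinitions.IZR 1)))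
   (Rdefinitions.IZR 0).
  rewrite derivD derivM derivX derivC addr0 mulr1 hornerD hornerM hornerX.
  rewrite -[Rdefinitions.IZR 1]/(1 : RR) -[Rdefinitions.IZR 0]/(0 : RR).
  rewrite !RplusE !RmultE.
  by rewrite mulr1 addr0.
apply: (derivable_pt_lim_plus (fun t => Rdefinitions.Rmult P.[t] t) (fun=> c));
  last exact: derivable_pt_lim_const.
apply: (derivable_pt_lim_mult (fun t => P.[t]) id) => //.
exact: derivable_pt_lim_id.
Qed.

Lemma ratio_nonincreasing (q r : {poly RR}) (a b : RR) :
  (forall x, q^`().[x] * r.[x] - q.[x] * r^`().[x] <= 0) ->
  a <= b -> (forall x, a <= x <= b -> 0 < r.[x]) ->
  q.[b] * r.[a] <= q.[a] * r.[b].
Proof.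
move=> W; rewrite le_eqVlt => /orP[/eqP-> //|ab] hr.
have [||c [hc [/RltP ac /RltP cb]]] := MVT_cor2
   (fun t => Rdefinitions.Rdiv q.[t] r.[t])
   (fun t => Rdefinitions.Rdiv (Rdefinitions.Rminus
      (Rdefinitions.Rmult q^`().[t] r.[t])
      (Rdefinitions.Rmult r^`().[t] q.[t])) (Rsqr r.[t])) a b.
- exact/RltP.
- move=> c [/RleP ac /RleP cb].
  apply: (derivable_pt_lim_div (fun t => q.[t]) (fun t => r.[t])).
  + exact: horner_derivable.
  + exact: horner_derivable.
  + by apply/eqP; rewrite lt0r_neq0 // hr // ac.
have ra : 0 < r.[a] by rewrite hr // lexx ltW.
have rb : 0 < r.[b] by rewrite hr // lexx ltW.
have rc0 : 0 < r.[c] by rewrite hr // !ltW.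
move: hc; rewrite !RdivE !RminusE !RmultE => hc.
have h : q.[b] / r.[b] <= q.[a] / r.[a].
  rewrite -subr_le0 hc; apply: mulr_le0_ge0; last by rewrite subr_ge0 ltW.
  rewrite pmulr_lle0; first by rewrite [r^`().[c] * _]mulrC W.
  by rewrite invr_gt0 /Rsqr RmultE mulr_gt0.
by rewrite -ler_pdivrMr // mulrAC -ler_pdivlMr.
Qed.

(** * Stable multi-affine polynomials and the operators 1 + y_i D_i *)

Lemma Im_Ninv (s : CC) : complex.Im s < 0 -> complex.Im (- s^-1) < 0.
Proof.
case: s => x y /= y0; rewrite opprK pmulr_llt0 // invr_gt0.
by rewrite ltr_pwDr ?sqr_ge0 // exprn_even_gt0 //= lt_eqF.
Qed.

Lemma poly_ReIm (P : {poly CC}) :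
  exists A B : {poly RR}, P = map_poly rc A + ii%:P * map_poly rc B.
Proof.
elim/poly_ind: P => [|P [x y] [A [B ->]]].
  by exists 0, 0; rewrite !rmorph0 mulr0 addr0.
exists (A * 'X + x%:P), (B * 'X + y%:P).
rewrite !rmorphD !rmorphM /= !map_polyX !map_polyC /=.
have -> : (x +i* y)%C = rc x + ii * rc y by rewrite [LHS]complexE.
by rewrite polyCD polyCM; ring.
Qed.

Lemma real_poly (P : {poly CC}) : (forall x : RR, P.[(x%:C)%C] \is Num.real) ->
  exists A : {poly RR}, P = map_poly rc A.
Proof.
have [A [B ->]] := poly_ReIm P.
move=> hr; exists A; suff -> : map_poly rc B = 0 by rewrite mulr0 addr0.
apply: (@poly_eq0_growth _ 0) => t _.
have := hr t; rewrite hornerD hornerM hornerC.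
rewrite !(horner_map rc) /= => /complex_realP[x].
by move/(congr1 (@complex.Im RR)) => /=; rewrite !mul0r !mul1r !add0r =>->;
  rewrite expr0n /= addr0 sqrtr0 mulr0.
Qed.

Definition reval a b (F : 'M[CC]_(a, b) -> CC) (X : 'M[RR]_(a, b)) : RR :=
  complex.Re (F (cM X)).

Definition real_fun a b (F : 'M[CC]_(a, b) -> CC) :=
  forall X : 'M[RR]_(a, b), F (cM X) \is Num.real.

Lemma revalE a b (F : 'M[CC]_(a, b) -> CC) X :
  real_fun F -> F (cM X) = ((reval F X)%:C)%C.
Proof. by move=> rF; rewrite /reval RRe_real. Qed.

Lemma real_line a b (F : 'M[CC]_(a, b) -> CC) (X Y : 'M[RR]_(a, b)) :
  bipoly F -> real_fun F -> exists P : {poly RR},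
    (forall s : CC, F (cM X + s *: cM Y) = (map_poly rc P).[s]) /\
    (forall s : RR, reval F (X + s *: Y) = P.[s]).
Proof.
move=> bF rF; have [P hP] := bipoly_line (cM X) (cM Y) bF.
have hPr (s : RR) : P.[(s%:C)%C] = F (cM (X + s *: Y)).
  by rewrite -hP cMD cMZ.
have [x|A PA] := @real_poly P; first by rewrite hPr.
rewrite {P}PA in hP hPr; exists A; split=> // s.
by apply: complexI; rewrite -revalE // -hPr horner_map.
Qed.

Definition affine_along a b (F : 'M[CC]_(a, b) -> CC) v :=
  forall z s, F (z + s *: v) = F z + s * (F (z + v) - F z).

Lemma affine_shift a b (F : 'M[CC]_(a, b) -> CC) v c :
  affine_along F v -> affine_along (fun z => F (z + c)) v.
Proof. by move=> aF z s; rewrite addrAC aF [z + v + c]addrAC. Qed.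

Lemma affineD a b (F G : 'M[CC]_(a, b) -> CC) v :
  affine_along F v -> affine_along G v -> affine_along (fun z => F z + G z) v.
Proof. by move=> aF aG z s; rewrite aF aG; ring. Qed.

Lemma affineN a b (F : 'M[CC]_(a, b) -> CC) v :
  affine_along F v -> affine_along (fun z => - F z) v.
Proof. by move=> aF z s; rewrite aF; ring. Qed.

Lemma affine_sum a b (I : Type) (r : seq I) (F : I -> 'M[CC]_(a, b) -> CC) v :
  (forall i, affine_along (F i) v) -> affine_along (fun z => \sum_(i <- r) F i z) v.
Proof.
move=> aF z s; rewrite -sumrB mulr_sumr -big_split /=.
by apply: eq_bigr => i _; apply: aF.
Qed.

(** Affineness along each [v i] makes unit increments act as partial derivatives, so this is the
    Taylor expansion along their sum. *)
Lemma affine_first_order a b (I : Type) (r : seq I) (v : I -> 'M[CC]_(a, b))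
    (F : 'M[CC]_(a, b) -> CC) z :
  bipoly F -> (forall i, affine_along F (v i)) ->
  exists R : {poly CC}, forall s, F (z + s *: \sum_(i <- r) v i) =
     F z + s * (\sum_(i <- r) (F (z + v i) - F z)) + s ^+ 2 * R.[s].
Proof.
move=> bF aF; elim: r => [|i r [R hR]].
  by exists 0 => s; rewrite !big_nil scaler0 horner0 !mulr0 !addr0.
pose G w := F (w + v i) - F w.
have bG : bipoly G by apply: bipolyD; [exact: bipoly_shift | exact: bipolyN].
have [Q hQ] := bipoly_line z (\sum_(i <- r) v i) bG.
have [Q1 hQ1] : exists Q1 : {poly CC}, forall s, Q.[s] = G z + s * Q1.[s].
  have Q0 : G z = Q.[0] by rewrite -hQ scale0r addr0.
  elim/poly_ind: Q {hQ} Q0 => [|Q c _] ->.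
    by exists 0 => s; rewrite !horner0 mulr0 addr0.
  by exists Q => s; rewrite !hornerMXaddC mulr0 add0r; ring.
exists (R + Q1) => s; rewrite !big_cons scalerDr addrA addrAC aF.
set w := z + s *: \sum_(j <- r) v j; have -> : F (w + v i) - F w = G w by [].
by rewrite /w hQ hQ1 hR hornerD /G; ring.
Qed.

Definition xdir (R : pzRingType) k m (j : 'I_k) (i : 'I_m) : 'M[R]_(k.+1, m) :=
  delta_mx (lift ord0 j) i.
Definition ydir (R : pzRingType) k m (i : 'I_m) : 'M[R]_(k.+1, m) :=
  delta_mx ord0 i.
Arguments xdir R {k m} j i.
Arguments ydir R {k m} i.

Lemma cM_xdir k m (j : 'I_k) (i : 'I_m) : cM (xdir RR j i) = xdir CC j i.
Proof. exact: map_delta_mx. Qed.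

Lemma cM_ydir k m (i : 'I_m) : cM (ydir RR i) = ydir CC i :> 'M_(k.+1, m).
Proof. exact: map_delta_mx. Qed.

(** On functions affine along every [xdir] a unit increment is the partial derivative, and [grad i]
    is D_i. *)
Definition grad k m (i : 'I_m) (F : 'M[CC]_(k.+1, m) -> CC) z :=
  \sum_(j < k) (F (z + xdir CC j i) - F z).

(* Row 0 of the matrix holds the variables y_i, rows 1 .. k the copies of the
   variables x_i; [mix i] is the operator 1 + y_i D_i. *)
Definition mix k m (i : 'I_m) (F : 'M[CC]_(k.+1, m) -> CC) z :=
  F z + z ord0 i * grad i F z.

(** The y-variables may be real, so that the vector with zero y-row and ones elsewhere is a
    hyperbolicity direction. *)
Definition stable k m (F : 'M[CC]_(k.+1, m) -> CC) :=
  forall z : 'M[CC]_(k.+1, m), (forall j i, 0 < complex.Im (z (lift ord0 j) i)) ->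
    (forall i, 0 <= complex.Im (z ord0 i)) -> F z != 0.

Record mixable k m N (F : 'M[CC]_(k.+1, m) -> CC) : Prop := Mixable {
  mixable_bipoly : bipoly F;
  mixable_homf : homf N F;
  mixable_real : real_fun F;
  mixable_stable : stable F;
  mixable_affine : forall j i, affine_along F (xdir CC j i) }.

Definition yfree k m (i : 'I_m) (F : 'M[CC]_(k.+1, m) -> CC) :=
  forall z c, F (z + c *: ydir CC i) = F z.

Lemma grad_bipoly k m i (F : 'M[CC]_(k.+1, m) -> CC) : bipoly F -> bipoly (grad i F).
Proof.
move=> bF; apply: bipoly_sum => j.
by apply: bipolyD; [exact: bipoly_shift | exact: bipolyN].
Qed.

Lemma grad_real k m i (F : 'M[CC]_(k.+1, m) -> CC) :
  real_fun F -> real_fun (grad i F).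
Proof.
by move=> rF X; apply: rpred_sum => j _; rewrite rpredB // -cM_xdir -cMD.
Qed.

Lemma grad_affine k m i (F : 'M[CC]_(k.+1, m) -> CC) v :
  affine_along F v -> affine_along (grad i F) v.
Proof.
move=> aF; apply: affine_sum => j.
by apply: affineD; [exact: affine_shift | exact: affineN].
Qed.

Lemma grad_yfree k m i i' (F : 'M[CC]_(k.+1, m) -> CC) :
  yfree i F -> yfree i (grad i' F).
Proof.
by move=> yF z c; apply: eq_bigr => j _; rewrite addrAC !yF.
Qed.

(** F is affine along [xdir], with its zero at s = - F / q for q the increment. Moving up by s with
    Im s >= 0 would stay in the region of stability, so Im s < 0, and q / F = - 1 / s. *)
Lemma increment_sign k m j i (F : 'M[CC]_(k.+1, m) -> CC) (z : 'M[CC]_(k.+1, m)) :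
  stable F -> affine_along F (xdir CC j i) ->
  (forall j i, 0 < complex.Im (z (lift ord0 j) i)) ->
  (forall i, 0 <= complex.Im (z ord0 i)) ->
  (F (z + xdir CC j i) - F z) / F z = 0 \/
  complex.Im ((F (z + xdir CC j i) - F z) / F z) < 0.
Proof.
move=> sF aF zx zy; set q := _ - _.
have [->|q0] := eqVneq q 0; [by left; rewrite mul0r | right].
have F0 : F z != 0 by exact: sF.
have -> : q / F z = - (- F z / q)^-1.
  by rewrite invf_div invrN mulrN opprK.
apply: Im_Ninv; rewrite ltNge; apply/negP => s0.
have /eqP : F (z + (- F z / q) *: xdir CC j i) = 0.
  by rewrite aF -/q divfK // subrr.
apply/negP; apply: sF => [j' i'|i']; rewrite !mxE /=.
  have := zx j' i'; case: (z _ _) => x y /= y0.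
  case: (_ && _); rewrite ?mulr1 ?mulr0 /=; last by lra.
  by case: (- F z / q) s0 => x' y' /= y'0; lra.
by rewrite mulr0 addr0.
Qed.

Lemma grad_sign k m i (F : 'M[CC]_(k.+1, m) -> CC) (z : 'M[CC]_(k.+1, m)) :
  stable F -> (forall j i, affine_along F (xdir CC j i)) ->
  (forall j i, 0 < complex.Im (z (lift ord0 j) i)) ->
  (forall i, 0 <= complex.Im (z ord0 i)) ->
  grad i F z / F z = 0 \/ complex.Im (grad i F z / F z) < 0.
Proof.
move=> sF aF zx zy; rewrite /grad mulr_suml.
apply: (big_ind (fun w : CC => w = 0 \/ complex.Im w < 0)); first by left.
  move=> x y [->|hx] [->|hy]; rewrite ?addr0 ?add0r; [left|right|right|right] => //.
  by case: x y hx hy => x x' [y y'] /=; lra.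
by move=> j _; apply: increment_sign.
Qed.

Lemma mix_ext k m i (F G : 'M[CC]_(k.+1, m) -> CC) : F =1 G -> mix i F =1 mix i G.
Proof.
move=> FG z; rewrite /mix /grad FG; congr (_ + _ * _).
by apply: eq_bigr => j _; rewrite !FG.
Qed.

Lemma gradC k m i i' (F : 'M[CC]_(k.+1, m) -> CC) :
  grad i (grad i' F) =1 grad i' (grad i F).
Proof.
move=> z; rewrite /grad; under eq_bigr do rewrite -sumrB.
under [RHS]eq_bigr do rewrite -sumrB.
rewrite exchange_big; apply: eq_bigr => j _; apply: eq_bigr => j' _.
by rewrite [z + _ + _]addrAC; ring.
Qed.

Lemma xdir_row0 (R : pzRingType) k m (j : 'I_k) (i i' : 'I_m) :
  xdir R j i ord0 i' = 0.
Proof. by rewrite mxE. Qed.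

Lemma grad_mix k m i i' (F : 'M[CC]_(k.+1, m) -> CC) z :
  grad i (mix i' F) z = grad i F z + z ord0 i' * grad i (grad i' F) z.
Proof.
rewrite /grad mulr_sumr -big_split; apply: eq_bigr => j _ /=.
by rewrite /mix mxE xdir_row0 addr0 /grad; ring.
Qed.

Lemma mixC k m i i' (F : 'M[CC]_(k.+1, m) -> CC) :
  mix i (mix i' F) =1 mix i' (mix i F).
Proof.
move=> z; rewrite {1}/mix [RHS]/mix !grad_mix {1}/mix [mix i F z]/mix.
by rewrite (gradC i i'); ring.
Qed.

Lemma mix_yfree k m i i' (F : 'M[CC]_(k.+1, m) -> CC) :
  i' != i -> yfree i F -> yfree i (mix i' F).
Proof.
move=> ii' yF z c; rewrite /mix yF (grad_yfree _ yF); congr (_ + _ * _).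
by rewrite !mxE (negPf ii') andbF mulr0 addr0.
Qed.

(** Stability: F (1 + y_i D_i F / F) could vanish only at y_i = - (D_i F / F)^-1, whose imaginary
    part is negative because that of D_i F / F is. *)
Lemma mixable_mix k m N i (F : 'M[CC]_(k.+1, m) -> CC) :
  mixable N F -> mixable N (mix i F).
Proof.
case=> bF hF rF sF aF; split.
- by apply: bipolyD => //; apply: bipolyM; [exact: bipoly_entry | exact: grad_bipoly].
- move=> c z c0; rewrite /mix hF // mulrDr; congr (_ + _).
  (* D_i F is homogeneous of degree N - 1, stated without the subtraction; the factor y_i restores
     degree N. *)
  have cg : c * grad i F (c *: z) = c ^+ N * grad i F z.
    rewrite /grad !mulr_sumr; apply: eq_bigr => j _.
    have := hF c (z + xdir CC j i) c0; rewrite scalerDr aF => h.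
    by rewrite [RHS]mulrBr -h hF //; ring.
  by rewrite mxE mulrCA -cg; ring.
- move=> X; rewrite rpredD // rpredM ?grad_real //.
  by rewrite mxE complex_real.
- move=> z zx zy; have F0 := sF z zx zy.
  have -> : mix i F z = F z * (1 + z ord0 i * (grad i F z / F z)).
    by rewrite /mix; field.
  rewrite mulf_neq0 //.
  have [->|Im0] := grad_sign i sF aF zx zy; first by rewrite mulr0 addr0 oner_eq0.
  apply/eqP => h; have := zy i; rewrite leNgt => /negP; apply.
  set w := grad i F z / F z in Im0 h *.
  have w0 : w != 0 by apply: contraTneq Im0 => ->; rewrite ltxx.
  suff -> : z ord0 i = - w^-1 by exact: Im_Ninv.
  apply: (mulIf w0); rewrite mulNr mulVf //.
  by apply/eqP; rewrite -subr_eq0 opprK addrC h.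
- move=> j i' z s; have aG := grad_affine i (aF j i').
  by rewrite /mix (aF j i') (aG z s) !mxE /= mulr0 addr0; ring.
Qed.

Definition mixes k m (L : seq 'I_m) (F : 'M[CC]_(k.+1, m) -> CC) :=
  foldr (@mix k m) F L.

Lemma mixable_mixes k m N L (F : 'M[CC]_(k.+1, m) -> CC) :
  mixable N F -> mixable N (mixes L F).
Proof. by move=> mF; elim: L => //= i L IH; apply: mixable_mix. Qed.

Lemma mixes_yfree k m i L (F : 'M[CC]_(k.+1, m) -> CC) :
  i \notin L -> yfree i F -> yfree i (mixes L F).
Proof.
elim: L => //= i' L IH; rewrite inE negb_or => /andP[ii' iL] yF.
by apply: mix_yfree; [rewrite eq_sym | exact: IH].
Qed.

Lemma mixes_rem k m i L (F : 'M[CC]_(k.+1, m) -> CC) :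
  i \in L -> mixes L F =1 mix i (mixes (rem i L) F).
Proof.
elim: L => //= i' L IH; rewrite inE; have [->|] := eqVneq i' i => //= ne.
move=> iL z.
by rewrite (mix_ext _ (IH iL)) mixC.
Qed.

(** * Moving the barrier *)


Definition xone k m : 'M[RR]_(k.+1, m) := \matrix_(r, i) (r != ord0)%:R.
(** All k copies of the variable x_i move together, so the derivative along [wdir i] is D_i. *)
Definition wdir k m (i : 'I_m) : 'M[RR]_(k.+1, m) := \sum_(j < k) xdir RR j i.
Arguments xone {k m}.
Arguments wdir {k m} i.

Lemma stable_hyp_dir k m (F : 'M[CC]_(k.+1, m) -> CC) :
  stable F -> hyp_dir F xone.
Proof.
by move=> sF X; apply: sF => [j i|i]; rewrite !mxE /= ?mul0r ?mul1r ?mulr1 ?mulr0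
  ?addr0 ?add0r ?ltr01.
Qed.

Lemma cone_ge0 k m N (F : 'M[CC]_(k.+1, m) -> CC) (v : 'M[RR]_(k.+1, m)) :
  stable F -> homf N F -> (forall r i, 0 <= v r i) -> cone F xone v.
Proof.
move=> sF hF hv t t0; rewrite -(homf_neq0 _ hF ii_neq0); apply: sF => [j i|i].
  rewrite !mxE /= !mulr1 !mul0r !mul1r add0r.
  by rewrite ltr_wpDl // hv.
by rewrite !mxE /= !mul0r !mul1r add0r mulr0 addr0 hv.
Qed.

Lemma reval_neq0 a b (F : 'M[CC]_(a, b) -> CC) X :
  real_fun F -> (F (cM X) != 0) = (reval F X != 0).
Proof. by move=> rF; rewrite revalE // rc_neq0. Qed.

(** [cone] records only nonvanishing; the sign is carried from [xone] along a segment on which F has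
    no zero. *)
Lemma cone_gt0 k m N (F : 'M[CC]_(k.+1, m) -> CC) v (t : RR) :
  mixable N F -> 0 < reval F xone -> cone F xone v -> 0 < t ->
  0 < reval F (v + t *: xone).
Proof.
case=> bF hF rF sF _ F1 hv t0; have he := stable_hyp_dir sF.
have [P [_ hP]] := real_line xone (v + t *: xone - xone) bF rF.
have nz r : 0 <= r -> r <= 1 -> P.[r] != 0.
  move=> r0 r1; rewrite -hP -reval_neq0 //.
  have -> : xone + r *: (v + t *: xone - xone) = r *: v + (1 - r + r * t) *: xone.
    by mxring.
  apply: (coneZ hF he hv r0).
  by case: (eqVneq r 0) => [->|rn0]; [lra | have : 0 < r * t; [
    rewrite mulr_gt0 // lt_def rn0 | lra]].
have <- : P.[1] = reval F (v + t *: xone).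
  by rewrite -hP scale1r addrC subrK.
have P0 : 0 < P.[0] by rewrite -hP scale0r addr0.
rewrite ltNge; apply/negP => P1.
have [|x] := @polyrcf.poly_ivt _ P 0 1 ler01.
  by rewrite pmulr_rle0.
by rewrite in_itv /= => /andP[x0 x1]; rewrite rootE (negPf (nz x x0 x1)).
Qed.

Lemma reval_mix k m i (F : 'M[CC]_(k.+1, m) -> CC) (X : 'M[RR]_(k.+1, m)) : real_fun F ->
  reval (mix i F) X = reval F X + X ord0 i * reval (grad i F) X.
Proof.
move=> rF; apply: complexI; rewrite rmorphD rmorphM /= -!revalE //.
- by rewrite /mix mxE.
- exact: grad_real.
- by move=> Y; rewrite rpredD // rpredM ?grad_real // mxE complex_real.
Qed.

Lemma reval_yfree k m i (F : 'M[CC]_(k.+1, m) -> CC) (X : 'M[RR]_(k.+1, m)) (c : RR) :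
  yfree i F -> reval F (X + c *: ydir RR i) = reval F X.
Proof. by move=> yF; rewrite /reval cMD cMZ cM_ydir yF. Qed.

Lemma reval_mix_ydir k m i (F : 'M[CC]_(k.+1, m) -> CC) (X : 'M[RR]_(k.+1, m)) (c : RR) :
  real_fun F -> yfree i F -> X ord0 i = 0 ->
  reval (mix i F) (X + c *: ydir RR i) = reval F X + c * reval (grad i F) X.
Proof.
move=> rF yF X0; rewrite reval_mix // reval_yfree // reval_yfree; last exact: grad_yfree.
by rewrite !mxE X0 !eqxx mulr1 add0r.
Qed.

Lemma reval_mixes_xone k m N L (F : 'M[CC]_(k.+1, m) -> CC) : mixable N F ->
  reval (mixes L F) xone = reval F xone.
Proof.
move=> mF; elim: L => //= i L IH; rewrite reval_mix ?mxE /= ?mul0r ?addr0 //.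
exact: mixable_real (mixable_mixes L mF).
Qed.

Lemma grad_ratio k m N i (F : 'M[CC]_(k.+1, m) -> CC) (X : 'M[RR]_(k.+1, m)) (t : RR) : mixable N F -> 0 <= t ->
  (forall s, 0 <= s <= t -> 0 < reval F (X + s *: xone)) ->
  reval (grad i F) (X + t *: xone) * reval F X <=
  reval (grad i F) X * reval F (X + t *: xone).
Proof.
case=> bF hF rF sF aF t0 hpos.
have [r [hrC hr]] := real_line X xone bF rF.
have [q [hqC hq]] := real_line X xone (grad_bipoly i bF) (grad_real i rF).
have := @ratio_nonincreasing q r 0 t; rewrite -!hr -!hq !scale0r !addr0.
apply=> // [x|x hx]; last by rewrite -hr hpos.
apply: wronskian_le0 => z z0; rewrite -hrC -hqC.
have zx (j : 'I_k) (i' : 'I_m) :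
    0 < complex.Im ((cM X + z *: cM xone) (lift ord0 j) i').
  by rewrite !mxE /= mulr1; case: (z) z0 => x' y' /=; rewrite add0r.
have zy (i' : 'I_m) : 0 <= complex.Im ((cM X + z *: cM xone) ord0 i').
  by rewrite !mxE /= mulr0 addr0.
split; first exact: sF.
by have [->|/ltW //] := grad_sign i sF aF zx zy.
Qed.

Lemma reval_first_order k m i (F : 'M[CC]_(k.+1, m) -> CC) (X : 'M[RR]_(k.+1, m)) :
  bipoly F -> real_fun F -> (forall j, affine_along F (xdir CC j i)) ->
  exists R : {poly RR}, forall s,
    reval F (X + s *: wdir i) = reval F X + s * reval (grad i F) X + s ^+ 2 * R.[s].
Proof.
move=> bF rF aF.
have [R hR] := affine_first_order (index_enum 'I_k) (v := fun j => xdir CC j i)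
   (cM X) bF aF.
have [A [B RAB]] := poly_ReIm R; exists A => s.
have := hR (s%:C)%C; rewrite -/(grad i F (cM X)).
have -> : \sum_(j < k) xdir CC j i = cM (wdir i).
  by rewrite /wdir /cM raddf_sum; apply: eq_bigr => j _; rewrite -cM_xdir.
rewrite -cMZ -cMD.
rewrite !revalE //; last exact: grad_real.
have -> : R.[(s%:C)%C] = (A.[s] +i* B.[s])%C.
  rewrite RAB hornerD hornerM hornerC !(horner_map rc) /=.
  by rewrite [RHS]complexE.
rewrite -rmorphXn; move/(congr1 (@complex.Re RR)) => /= ->.
by rewrite !mul0r !subr0.
Qed.

(** Replacing F by F - D_i F can raise D_j F / F, by an amount governed by its derivative along
    [wdir i] at the shifted point. Concavity of F / D_j F bounds that derivative in terms of the
    drop over the shift, and c (del - 1) = del makes the drop pay for the rise. *)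
Lemma barrier_step k m N i j (F : 'M[CC]_(k.+1, m) -> CC) (a : 'M[RR]_(k.+1, m))
    (del c : RR) :
  mixable N F -> 0 < reval F xone -> yfree i F -> yfree j F -> i != j ->
  1 < del -> c * (del - 1) = del -> a ord0 i = 0 -> a ord0 j = 0 ->
  cone (mix i F) xone (a - c *: ydir RR i) ->
  cone (mix j F) xone (a - c *: ydir RR j) ->
  cone (mix j (mix i F)) xone (a + del *: wdir i - ydir RR i - c *: ydir RR j).
Proof.
move=> mF F1 yi yj ij d1 cd ai aj coneI coneJ sg sg0.
have [bF hF rF sF aF] := mF.
have mI : mixable N (mix i F) by exact: mixable_mix.
have mJ : mixable N (mix j F) by exact: mixable_mix.
have I1 : 0 < reval (mix i F) xone by rewrite reval_mix // mxE mul0r addr0.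
have J1 : 0 < reval (mix j F) xone by rewrite reval_mix // mxE mul0r addr0.
have heJ := stable_hyp_dir (mixable_stable mJ).
have heI := stable_hyp_dir (mixable_stable mI).
have d10 : 0 < del - 1 by lra.
have c0 : 0 < c by rewrite -(pmulr_lgt0 c d10) cd; lra.
pose b := a + sg *: xone + del *: wdir i.
have w00 i' : (wdir i : 'M[RR]_(k.+1, m)) ord0 i' = 0.
  by rewrite /wdir summxE big1 // => l _; rewrite xdir_row0.
have bi : b ord0 i = 0 by rewrite !mxE w00 ai /= !mulr0 !addr0.
have bj : b ord0 j = 0 by rewrite !mxE w00 aj /= !mulr0 !addr0.
have wge0 r l : 0 <= (wdir i : 'M[RR]_(k.+1, m)) r l.
  by rewrite /wdir summxE; apply: sumr_ge0 => q _; rewrite mxE ler0n.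
pose p0 := reval F b; pose pi := reval (grad i F) b; pose pj := reval (grad j F) b.
pose pij := reval (grad i (grad j F)) b.
have JE s : reval (mix j F) (b + s *: ydir RR j) = p0 + s * pj.
  by rewrite reval_mix_ydir.
have IE s : reval (mix i F) (b + s *: ydir RR i) = p0 + s * pi.
  by rewrite reval_mix_ydir.
have Jpos s : - c <= s -> 0 < p0 + s * pj.
  move=> sc; rewrite -JE.
  have -> : b + s *: ydir RR j = (a - c *: ydir RR j) +
     ((s + c) *: ydir RR j + del *: wdir i) + sg *: xone by rewrite /b; mxring.
  apply: (cone_gt0 mJ J1) => //.
  apply: (coneD (mixable_bipoly mJ) (mixable_homf mJ) heJ coneJ).
  apply: cone_ge0 (mixable_stable mJ) (mixable_homf mJ) _ => r l.
  have y0 : 0 <= (ydir RR j : 'M[RR]_(k.+1, m)) r l by rewrite mxE ler0n.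
  by rewrite mxE [X in X + _]mxE [X in _ + X]mxE addr_ge0 // mulr_ge0 //; lra.
have Ipos : 0 < p0 - c * pi.
  rewrite -mulNr -IE.
  have -> : b + - c *: ydir RR i = (a - c *: ydir RR i) + del *: wdir i
     + sg *: xone by rewrite /b; mxring.
  apply: (cone_gt0 mI I1) => //.
  apply: (coneD (mixable_bipoly mI) (mixable_homf mI) heI coneI).
  apply: cone_ge0 (mixable_stable mI) (mixable_homf mI) _ => r l.
  by rewrite mxE mulr_ge0 //; lra.
have p00 : 0 < p0 by have := Jpos 0; rewrite mul0r addr0; apply; lra.
have pj0 : 0 <= pj.
  rewrite leNgt; apply/negP => pjn; have := Jpos (- p0 / pj).
  have h : 0 <= - p0 / pj by rewrite mulNr -mulrN -invrN divr_ge0 //; lra.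
  by rewrite divfK ?lt_eqF // subrr ltxx => H; have : false by apply: H; lra.
have Jc := Jpos (- c) (lexx _).
pose rho := pj / p0.
have rho0 : 0 <= rho by rewrite divr_ge0 // ltW.
have rhop : pj = rho * p0 by rewrite /rho divfK // gt_eqF.
have Fpos t : 0 <= t -> 0 < reval F (b + t *: xone).
  move=> t0; have := reval_mix_ydir (X := b + t *: xone) 0 rF yj.
  rewrite scale0r mul0r !addr0 => <-; last first.
    by rewrite mxE bj !mxE /= mulr0 addr0.
  have -> : b + t *: xone = (a - c *: ydir RR j) +
     (c *: ydir RR j + del *: wdir i) + (sg + t) *: xone by rewrite /b; mxring.
  apply: (cone_gt0 mJ J1); last by lra.
  apply: (coneD (mixable_bipoly mJ) (mixable_homf mJ) heJ coneJ).
  apply: cone_ge0 (mixable_stable mJ) (mixable_homf mJ) _ => r l.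
  have y0 : 0 <= (ydir RR j : 'M[RR]_(k.+1, m)) r l by rewrite mxE ler0n.
  by rewrite mxE [X in X + _]mxE [X in _ + X]mxE addr_ge0 // mulr_ge0 //; lra.
have ratio t : 0 <= t -> reval (grad j F) (b + t *: xone)
    <= rho * reval F (b + t *: xone).
  move=> t0; have := grad_ratio (X := b) j mF t0.
  rewrite -/p0 -/pj rhop => H; rewrite -(ler_pM2r p00).
  by rewrite [leRHS]mulrAC; apply: H => s /andP[s0 _]; apply: Fpos.
(* D_j F / F is nonincreasing along the diagonal, so its value [rho] at [b] bounds it on the whole
   ray. *)
have coneB mu : rho < mu -> cone (mix j F) xone (b - mu^-1 *: ydir RR j).
  move=> hmu t t0; have mu0 : 0 < mu by lra.
  rewrite reval_neq0; last exact: mixable_real mJ.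
  have -> : b - mu^-1 *: ydir RR j + t *: xone =
     (b + t *: xone) + - mu^-1 *: ydir RR j by mxring.
  rewrite reval_mix_ydir //; last by rewrite mxE bj !mxE /= mulr0 addr0.
  have ht := ratio t (ltW t0); have ft := Fpos t (ltW t0).
  rewrite gt_eqF // mulNr subr_gt0 mulrC ltr_pdivrMr // mulrC.
  by apply: le_lt_trans ht _; rewrite ltr_pM2r.
pose A t := reval F (b - (t * del) *: wdir i).
pose B t := reval (grad j F) (b - (t * del) *: wdir i).
(* concavity of F / D_j F between [a] and [b], from convexity of the cone *)
have concave t : 0 < t -> t <= 1 ->
    0 <= rho * A t - (1 - t + t * rho * c) * B t.
  move=> t0 t1.
  pose G := (rho * A t - (1 - t + t * rho * c) * B t)%:P
            + 'X * (A t - t * c * B t)%:P.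
  suff : 0 <= G.[0] by rewrite /G hornerD hornerM hornerX !hornerC mul0r addr0.
  apply: poly_ge0_at0 => eta eta0 _.
  (* [rho] may be zero; hence its reciprocal is approached through [mu], the inequality is
     multiplied by [mu], and [eta] tends to 0. *)
  pose mu := rho + eta; have hmu : rho < mu by rewrite ltrDl.
  have mu0 : 0 < mu by lra.
  pose v := (1 - t) *: (b - mu^-1 *: ydir RR j) + t *: (a - c *: ydir RR j).
  have cv : cone (mix j F) xone v.
    apply: (coneD (mixable_bipoly mJ) (mixable_homf mJ) heJ).
      by apply: (coneZ (mixable_homf mJ) heJ); [exact: coneB | lra].
    by apply: (coneZ (mixable_homf mJ) heJ); [exact: coneJ | lra].
  have := cone_gt0 mJ J1 cv (mulr_gt0 t0 sg0).
  have -> : v + (t * sg) *: xone = (b - (t * del) *: wdir i)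
      + - ((1 - t) * mu^-1 + t * c) *: ydir RR j.
    by rewrite /v /b; mxring.
  rewrite reval_mix_ydir //; last first.
    by rewrite mxE bj !mxE w00 mulr0 oppr0 addr0.
  rewrite -/(A t) -/(B t) => h.
  have : 0 < mu * (A t + - ((1 - t) / mu + t * c) * B t) by rewrite mulr_gt0.
  have -> : mu * (A t + - ((1 - t) / mu + t * c) * B t) =
     mu * A t - (1 - t + mu * t * c) * B t by field; rewrite gt_eqF.
  have -> : G.[eta] = mu * A t - (1 - t + mu * t * c) * B t.
    rewrite /G hornerD hornerM hornerX !hornerC /mu; ring.
  exact: ltW.
have [R1 hR1] := reval_first_order (i := i) b bF rF (fun l => aF l i).
have [R2 hR2] := reval_first_order (i := i) b (grad_bipoly j bF) (grad_real j rF)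
   (fun l => grad_affine j (aF l i)).
(* At t = 0 the expression in [concave] vanishes, so its coefficient of t is nonnegative. Here (pij
   - rho pi) / p0 is the derivative of D_j F / F along [wdir i]. *)
have key : 0 <= del * (pij - rho * pi) + pj * (1 - rho * c).
  pose X1 : {poly RR} := (- del)%:P * 'X.
  pose H := (del * (pij - rho * pi) + pj * (1 - rho * c))%:P
    + 'X * ((rho * del ^+ 2)%:P * (R1 \Po X1) - (del ^+ 2)%:P * (R2 \Po X1)
      - ((1 - rho * c) * del * pij)%:P
      + 'X * ((1 - rho * c) * del ^+ 2)%:P * (R2 \Po X1)).
  suff : 0 <= H.[0] by rewrite /H hornerD hornerM hornerX hornerC mul0r addr0.
  apply: poly_ge0_at0 => t t0 t1.
  rewrite -(pmulr_rge0 _ t0); apply: le_trans (concave t t0 t1) _.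
  rewrite /A /B -scaleNr hR1 hR2 -/p0 -/pi -/pj -/pij /H.
  rewrite !(hornerD, hornerN, hornerM, hornerX, hornerC, horner_comp).
  have -> : - (t * del) = - del * t by ring.
  rewrite le_eqVlt; apply/orP; left; apply/eqP.
  rewrite rhop; ring.
rewrite reval_neq0; last exact: mixable_real (mixable_mix j mI).
have -> : a + del *: wdir i - ydir RR i - c *: ydir RR j + sg *: xone
   = (b + (-1) *: ydir RR i) + - c *: ydir RR j by rewrite /b; mxring.
rewrite reval_mix_ydir; first last.
- by rewrite mxE bj !mxE (eq_sym j) (negPf ij) andbF mulr0 addr0.
- exact: mix_yfree.
- exact: mixable_real mI.
have -> : reval (grad j (mix i F)) (b + -1 *: ydir RR i) = pj - pij.
  apply: complexI; rewrite -revalE; last by apply: grad_real; apply: mixable_real mI.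
  rewrite grad_mix revalE; last exact: grad_real.
  rewrite (gradC j i) revalE; last by apply: grad_real; apply: grad_real.
  rewrite !reval_yfree; try by do ?apply: grad_yfree.
  have -> : cM (b + -1 *: ydir RR i) ord0 i = (- 1 : RR)%:C%C.
    by rewrite mxE mxE bi !mxE !eqxx mulr1 add0r.
  by rewrite -/pj -/pij; rewrite -rmorphM -rmorphD; rewrite mulN1r.
rewrite IE gt_eqF //.
have rc1 : rho * c < 1.
  by rewrite -(ltr_pM2r p00) mul1r; move: Jc; rewrite rhop; lra.
rewrite -(pmulr_rgt0 _ d10).
(* By c (del - 1) = del, the difference of the two sides is exactly the quantity in [key]. *)
have e1 : (1 - rho * c) * ((del - 1) * (p0 - pi) - rho * p0) <=
  (del - 1) * (p0 + -1 * pi + - c * (pj - pij)).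
  rewrite rhop in key *; rewrite -subr_ge0.
  set lhs := (X in 0 <= X).
  have -> : lhs = del * (pij - rho * pi) + rho * p0 * (1 - rho * c)
      + (c * (del - 1) - del) * (pij - rho * pi) by rewrite /lhs; ring.
  by rewrite cd subrr mul0r addr0.
apply: lt_le_trans e1; apply: mulr_gt0; first lra.
(* [(del - 1) (p0 - pi) > (del - 1) / del * p0 = p0 / c > rho p0] *)
rewrite -(pmulr_rgt0 _ c0).
have -> : c * ((del - 1) * (p0 - pi) - rho * p0) =
    (del - 1) * (p0 - c * pi) + (1 - rho * c) * p0 + (c * (del - 1) - del) * p0.
  by ring.
rewrite cd subrr mul0r addr0; apply: addr_gt0; apply: mulr_gt0 => //; lra.
Qed.

(** * The averaged polynomial and interlacing *)


Definition yone k m : 'M[RR]_(k.+1, m) := \sum_i ydir RR i.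
Arguments yone {k m}.

Lemma yone_row0 k m (i : 'I_m) : (yone : 'M[RR]_(k.+1, m)) ord0 i = 1.
Proof.
rewrite /yone summxE (bigD1 i) //= mxE !eqxx big1 ?addr0 // => j ji.
by rewrite mxE eq_sym (negPf ji) andbF.
Qed.

Lemma wdir_row0 k m (i i' : 'I_m) : (wdir i : 'M[RR]_(k.+1, m)) ord0 i' = 0.
Proof. by rewrite /wdir summxE big1 // => l _; rewrite xdir_row0. Qed.

Lemma sum_wdir k m : \sum_i wdir i = xone :> 'M[RR]_(k.+1, m).
Proof.
apply/matrixP => r i; rewrite summxE [RHS]mxE.
under eq_bigr do rewrite summxE.
case: (unliftP ord0 r) => [j|] ->; last first.
  by rewrite big1 // => i' _; rewrite big1 // => j _; rewrite xdir_row0.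
rewrite (bigD1 i) //= [X in _ + X]big1 => [|i' ii']; last first.
  by rewrite big1 // => j' _; rewrite mxE [i == i']eq_sym (negPf ii') andbF.
rewrite (bigD1 j) //= big1 => [|j' jj']; first by rewrite mxE !eqxx !addr0.
by rewrite mxE (inj_eq lift_inj) [j == j']eq_sym (negPf jj').
Qed.

Lemma cone_ext a b (F G : 'M[CC]_(a, b) -> CC) e v :
  F =1 G -> cone F e v -> cone G e v.
Proof. by move=> FG h t t0; rewrite -FG h. Qed.

Section BarrierChain.
Variables (k m N : nat) (F : 'M[CC]_(k.+1, m) -> CC) (t del c : RR).
Hypotheses (mF : mixable N F) (F1 : 0 < reval F xone) (yF : forall i, yfree i F).
Hypotheses (d1 : 1 < del) (cd : c * (del - 1) = del).
Hypothesis start : forall i, cone (mix i F) xone (t *: xone - c *: ydir RR i).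

(** The induction treats all [j] outside the list at once, because [barrier_step] consumes the
    bounds for [i] and [j] at the same point. *)
Lemma barrier_chain L j : uniq L -> j \notin L ->
  cone (mix j (mixes L F)) xone
    (t *: xone + \sum_(i <- L) (del *: wdir i - ydir RR i) - c *: ydir RR j).
Proof.
elim: L j => [|i L IH] j /=.
  by move=> _ _; rewrite big_nil addr0; apply: start.
move=> /andP[iL uL]; rewrite inE negb_or => /andP[ji jL].
have X0 l : l \notin L -> (t *: xone + \sum_(i <- L) (del *: wdir i - ydir RR i)
    : 'M[RR]_(k.+1, m)) ord0 l = 0.
  move=> lL; rewrite mxE summxE big1_seq => [|i' /andP[_ i'L]].
    by rewrite !mxE /= mulr0 addr0.
  rewrite mxE mxE wdir_row0 mulr0 add0r !mxE eqxx /=.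
  by case: eqP lL => [->|]; rewrite ?i'L ?oppr0.
have := barrier_step (mixable_mixes L mF) _ (mixes_yfree iL (yF i))
  (mixes_yfree jL (yF j)) _ d1 cd (X0 i iL) (X0 j jL) (IH i uL iL) (IH j uL jL).
rewrite (reval_mixes_xone L mF) eq_sym => /(_ F1 ji).
rewrite big_cons.
suff -> : t *: xone + (del *: wdir i - ydir RR i +
   \sum_(j0 <- L) (del *: wdir j0 - ydir RR j0)) =
   t *: xone + \sum_(i0 <- L) (del *: wdir i0 - ydir RR i0) + del *: wdir i
   - ydir RR i :> 'M_(k.+1, m) by [].
by move: (\sum_(i0 <- L) _) => S; rewrite [_ + S]addrC !addrA.
Qed.

Lemma cone_average :
  cone (mixes (enum 'I_m) F) xone
    ((m%:R * t + (m%:R - 1) * del) *: xone - (m%:R - 1 + c) *: yone).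
Proof.
have mG := mixable_mixes (enum 'I_m) mF.
(* The certificate of [l] as a term common to all indices minus a correction in [l] alone. In the
   sum each y_i receives -1 from m - 1 certificates and -c from one. *)
pose V l : 'M[RR]_(k.+1, m) := (t + del) *: xone - yone
   - (del *: wdir l - (1 - c) *: ydir RR l).
have -> : (m%:R * t + (m%:R - 1) * del) *: xone - (m%:R - 1 + c) *: yone =
   \sum_(l < m) V l.
  rewrite /V big_split /= sumr_const card_ord sumrN sumrB -!scaler_sumr.
  rewrite sum_wdir -/yone -scaler_nat; mxring.
apply: (cone_sum (mixable_bipoly mG) (mixable_homf mG)
  (stable_hyp_dir (mixable_stable mG))) => l _.
have lin : l \in enum 'I_m by rewrite mem_enum.
apply: (cone_ext (F := mix l (mixes (rem l (enum 'I_m)) F))) => [z|].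
  by rewrite -mixes_rem.
have -> : V l = t *: xone + \sum_(i <- rem l (enum 'I_m)) (del *: wdir i - ydir RR i)
    - c *: ydir RR l.
  have : \sum_(i <- enum 'I_m) (del *: wdir i - ydir RR i) =
      del *: xone - yone :> 'M_(k.+1, m).
    by rewrite big_enum /= sumrB -scaler_sumr sum_wdir.
  rewrite (perm_big _ (perm_to_rem lin)) big_cons /=.
  move/(canRL (addKr _)) => ->; rewrite /V; mxring.
apply: barrier_chain; first by rewrite rem_uniq // enum_uniq.
by rewrite mem_rem_uniq ?enum_uniq // inE eqxx.
Qed.

Lemma mixes_gt0 T : 0 < m%:R - 1 + c ->
  (m%:R * t + (m%:R - 1) * del) / (m%:R - 1 + c) < T ->
  0 < reval (mixes (enum 'I_m) F) (T *: xone - yone).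
Proof.
set Q := m%:R - 1 + c; set A := m%:R * t + _ => Q0 hT.
have mG := mixable_mixes (enum 'I_m) mF.
have := @cone_gt0 _ _ _ _ (Q^-1 *: (A *: xone - Q *: yone)) (T - A / Q) mG.
rewrite (reval_mixes_xone _ mF) => /(_ F1).
have -> : Q^-1 *: (A *: xone - Q *: yone) + (T - A / Q) *: xone =
    T *: xone - yone :> 'M_(k.+1, m) by mxfield; rewrite gt_eqF.
apply; last by rewrite subr_gt0.
apply: (coneZ (mixable_homf mG) (stable_hyp_dir (mixable_stable mG))).
  exact: cone_average.
by rewrite invr_ge0 ltW.
Qed.

End BarrierChain.

Lemma reval_eventually_gt0 k m N (F : 'M[CC]_(k.+1, m) -> CC) (X : 'M[RR]_(k.+1, m)) T :
  mixable N F -> 0 < reval F xone ->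
  exists2 M : RR, T <= M & 0 < reval F (X + M *: xone).
Proof.
case=> bF hF rF sF aF F1.
have [P [_ hP]] := real_line xone X bF rF.
have P0 : P.[0] = reval F xone by rewrite -hP scale0r addr0.
have [|d d0 hd] := @poly_cont _ 0 P (reval F xone) => //.
pose M := Num.max T (Num.max 1 (2 / d)).
exists M; first by rewrite /M le_max lexx.
have M0 : 0 < M by rewrite /M !lt_max ltr01 /= orbT.
have M1 : 2 / d <= M by rewrite /M !le_max lexx !orbT.
have Md : `|M^-1 - 0| < d.
  rewrite subr0 gtr0_norm ?invr_gt0 // -div1r ltr_pdivrMr //.
  by move: M1; rewrite ler_pdivrMr // mulrC; lra.
have := hd _ Md; rewrite P0 ltr_norml => /andP[h _].
have h1 : 0 < reval F (xone + M^-1 *: X) by rewrite hP; lra.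
have -> : X + M *: xone = M *: (xone + M^-1 *: X) by mxfield; rewrite gt_eqF.
rewrite /reval cMZ hF ?rc_neq0 ?gt_eqF // revalE // -rmorphXn -rmorphM /=.
by rewrite mulr_gt0 ?exprn_gt0.
Qed.

(* With r = F and q = D_i F along the diagonal, r / (r - q) is nonincreasing
   wherever r - q is positive, so r cannot vanish there either. *)
Lemma interlacing_step k m N i (F : 'M[CC]_(k.+1, m) -> CC) (X : 'M[RR]_(k.+1, m))
    (T : RR) :
  mixable N F -> 0 < reval F xone -> yfree i F -> X ord0 i = -1 ->
  (forall t, T <= t -> 0 < reval (mix i F) (X + t *: xone)) ->
  (0 < k)%N ->
  exists j : 'I_k, forall t, T <= t ->
    0 < reval F (X - k%:R *: xdir RR j i + t *: xone).
Proof.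
move=> mF F1 yF Xi hpos k0; have [bF hF rF sF aF] := mF.
pose G j z := F (z + xdir CC j i) - F z.
have bG j : bipoly (G j) by apply: bipolyD; [exact: bipoly_shift | exact: bipolyN].
have rG j : real_fun (G j) by move=> Y; rewrite rpredB // -cM_xdir -cMD.
have [r [hrC hr]] := real_line X xone bF rF.
have [q [hqC hq]] := real_line X xone (grad_bipoly i bF) (grad_real i rF).
have zx z (j : 'I_k) (i' : 'I_m) : 0 < complex.Im z ->
    0 < complex.Im ((cM X + z *: cM xone) (lift ord0 j) i').
  by rewrite !mxE /= mulr1; case: z => x' y' /=; rewrite add0r.
have zy z (i' : 'I_m) : 0 <= complex.Im ((cM X + z *: cM xone) ord0 i').
  by rewrite !mxE /= mulr0 addr0.
have W : forall x, q^`().[x] * r.[x] - q.[x] * r^`().[x] <= 0.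
  apply: wronskian_le0 => z z0; rewrite -hrC -hqC.
  split; first by apply: sF => [j l|l]; [exact: zx | exact: zy].
  by have [->|/ltW //] := grad_sign i sF aF (fun j l => zx z j l z0) (zy z).
have Q0 t : T <= t -> 0 < (r - q).[t].
  move=> /hpos; rewrite reval_mix //.
  have -> : (X + t *: xone) ord0 i = -1 by rewrite !mxE Xi /= mulr0 addr0.
  by rewrite mulN1r hr hq hornerD hornerN.
have r0 t : T <= t -> 0 < r.[t].
  move=> tT; have [M tM hM] := reval_eventually_gt0 X t mF F1.
  rewrite hr in hM.
  have := @ratio_nonincreasing r (r - q) t M _ tM _.
  have W' x : r^`().[x] * (r - q).[x] - r.[x] * (r - q)^`().[x] <= 0.
    apply: le_trans (W x); rewrite le_eqVlt; apply/orP; left; apply/eqP.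
    by rewrite derivB !(hornerD, hornerN); ring.
  move=> /(_ W') H.
  have {}H : r.[M] * (r - q).[t] <= r.[t] * (r - q).[M].
    by apply: H => x /andP[tx _]; apply: Q0; apply: le_trans tx.
  rewrite -(pmulr_lgt0 _ (Q0 M (le_trans tT tM))).
  by apply: lt_le_trans H; rewrite mulr_gt0 ?Q0.
have GE j t : reval F (X - k%:R *: xdir RR j i + t *: xone) =
    reval F (X + t *: xone) - k%:R * reval (G j) (X + t *: xone).
  apply: complexI; rewrite rmorphB rmorphM /= -!revalE //.
  have -> : cM (X - k%:R *: xdir RR j i + t *: xone) =
      cM (X + t *: xone) + (- (k%:R : RR))%:C%C *: xdir CC j i.
    by rewrite -cM_xdir -cMZ -cMD; congr cM; mxring.
  by rewrite aF rmorphN mulNr.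
(* The values of the k choices at T add up to k (r - q)(T) > 0; the factor k in the shift is what
   balances the sum. *)
have [j hj] : exists j, 0 < reval F (X - k%:R *: xdir RR j i + T *: xone).
  apply: Classical_Prop.NNPP => H.
  have : \sum_(j < k) reval F (X - k%:R *: xdir RR j i + T *: xone) <= 0.
    apply: sumr_le0 => j _; rewrite leNgt; apply/negP => h; apply: H; by exists j.
  under eq_bigr do rewrite GE.
  rewrite sumrB sumr_const card_ord -mulr_sumr.
  have -> : \sum_(j < k) reval (G j) (X + T *: xone) = q.[T].
    rewrite -hq; apply: complexI; rewrite -[RHS]revalE; last exact: grad_real.
    by rewrite rmorph_sum; apply: eq_bigr => j _; rewrite /= -revalE.
  rewrite hr -[r.[T] *+ k]mulr_natl -mulrBr pmulr_rle0 ?ltr0n //.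
  by rewrite leNgt; have := Q0 T (lexx _); rewrite hornerD hornerN => ->.
exists j => t tT; rewrite GE hr; move: hj; rewrite GE hr.
have [g [hgC hg]] := real_line X xone (bG j) (rG j).
rewrite !hg !subr_gt0 => hj.
(* For the chosen [j] the ratio g / r is nonincreasing, so k g < r persists from T onwards. *)
have Wg : forall x, g^`().[x] * r.[x] - g.[x] * r^`().[x] <= 0.
  apply: wronskian_le0 => z z0; rewrite -hrC -hgC.
  split; first by apply: sF => [j' l|l]; [exact: zx | exact: zy].
  by have [->|/ltW //] := increment_sign sF (aF j i) (fun j l => zx z j l z0) (zy z).
have := ratio_nonincreasing Wg tT (fun x hx => r0 x (proj1 (andP hx))).
have rT := r0 T (lexx _); have rt := r0 t tT => H.
rewrite -(ltr_pM2r rT) -mulrA; apply: le_lt_trans (_ : k%:R * (g.[T] * r.[t]) < _).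
  by rewrite ler_wpM2l ?ler0n.
by rewrite mulrA [ltRHS]mulrC ltr_pM2r.
Qed.

Lemma interlacing k m N L (F : 'M[CC]_(k.+1, m) -> CC) (X : 'M[RR]_(k.+1, m)) (T : RR) :
  mixable N F -> 0 < reval F xone -> (forall i, yfree i F) -> (0 < k)%N -> uniq L ->
  (forall i, X ord0 i = -1) ->
  (forall t, T <= t -> 0 < reval (mixes L F) (X + t *: xone)) ->
  exists f : 'I_m -> 'I_k, forall t, T <= t ->
    0 < reval F (X - \sum_(i <- L) k%:R *: xdir RR (f i) i + t *: xone).
Proof.
move=> mF F1 yF k0; elim: L X => [|i L IH] X /=.
  by move=> _ _ h; exists (fun=> Ordinal k0) => t tT; rewrite big_nil subr0 h.
move=> /andP[iL uL] hX hpos.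
have [|j hj] := interlacing_step (mixable_mixes L mF) _ (mixes_yfree iL (yF i))
   (hX i) hpos k0.
  by rewrite (reval_mixes_xone L mF).
have [|//|f hf] := IH (X - k%:R *: xdir RR j i) uL.
  by move=> i'; rewrite !mxE hX /= mulr0 oppr0 addr0.
exists (fun i' => if i' == i then j else f i') => t tT.
rewrite big_cons eqxx opprD addrA.
under eq_big_seq => i' i'L.
  rewrite (_ : i' == i = false); last by apply: contraNF iL => /eqP <-.
over.
exact: hf.
Qed.

(** * Products of copies of a polynomial *)


Definition copies k m (p : 'rV[CC]_m -> CC) (z : 'M[CC]_(k.+1, m)) : CC :=
  \prod_(j < k) p (row (lift ord0 j) z).

Lemma cM_row a b (X : 'M[RR]_(a, b)) i : row i (cM X) = cM (row i X).
Proof. by rewrite /cM map_row. Qed.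

Lemma mixable_copies k m d (p : 'rV[CC]_m -> CC) :
  bipoly p -> homf d p -> real_fun p ->
  (forall z : 'rV[CC]_m, (forall i, 0 < complex.Im (z 0 i)) -> p z != 0) ->
  (forall i, affine_along p (delta_mx 0 i)) ->
  mixable (d * k) (copies (k := k) p).
Proof.
move=> bp hp rp sp ap; split.
- apply: bipoly_prod => j.
  exact: (bipoly_linear (row (lift ord0 j)) bp).
- move=> c z c0; rewrite /copies exprM -[X in _ ^+ X](card_ord k) -prodr_const.
  by rewrite -big_split; apply: eq_bigr => j _; rewrite linearZ hp.
- by move=> X; apply: rpred_prod => j _; rewrite cM_row.
- move=> z zx zy; apply/prodf_neq0 => j _; apply: sp => i; rewrite mxE.
  exact: zx.
- move=> j i z s.
  have BD w : copies p w = p (row (lift ord0 j) w) *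
      \prod_(j' < k | j' != j) p (row (lift ord0 j') w) by exact: bigD1.
  have rowE c : row (lift ord0 j) (z + c *: xdir CC j i)
      = row (lift ord0 j) z + c *: delta_mx 0 i.
    by apply/matrixP => a b; rewrite !mxE eqxx (ord1 a).
  have rowE' c (j' : 'I_k) : j' != j ->
      row (lift ord0 j') (z + c *: xdir CC j i) = row (lift ord0 j') z.
    move=> jj'; apply/matrixP => a b.
    by rewrite !mxE (inj_eq lift_inj) (negPf jj') mulr0 addr0.
  rewrite !{}BD rowE ap.
  have -> : z + xdir CC j i = z + 1 *: xdir CC j i by rewrite scale1r.
  have prodE c : \prod_(j' < k | j' != j) p (row (lift ord0 j') (z + c *: xdir CC j i))
      = \prod_(j' < k | j' != j) p (row (lift ord0 j') z).
    by apply: eq_bigr => j' jj'; rewrite rowE'.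
  by rewrite !prodE rowE [1 *: delta_mx 0 i]scale1r; ring.
Qed.

Lemma copies_yfree k m (p : 'rV[CC]_m -> CC) i : yfree i (copies (k := k) p).
Proof.
move=> z c; apply: eq_bigr => j _; congr p; apply/matrixP => a b.
by rewrite !mxE /= mulr0 addr0.
Qed.

Lemma row_xone k m (j : 'I_k) : row (lift ord0 j) xone = const_mx 1 :> 'rV[RR]_m.
Proof. by apply/matrixP => a b; rewrite !mxE. Qed.

Lemma reval_copies_xone k m (p : 'rV[CC]_m -> CC) :
  p (cM (const_mx 1)) = 1 -> reval (copies (k := k) p) xone = 1.
Proof.
move=> p1; rewrite /reval /copies big1 // => j _.
by rewrite cM_row row_xone p1.
Qed.

(* The barrier at the starting point t 1 holds because D_i log p = tau_i / t. *)
Lemma copies_start k m d (p : 'rV[CC]_m -> CC) (tau t c eps : RR) i :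
  homf d p -> p (cM (const_mx 1)) = 1 ->
  p (cM (const_mx 1) + delta_mx 0 i) = (1 + tau)%:C%C ->
  (forall i, affine_along p (delta_mx 0 i)) ->
  0 <= c -> tau <= eps -> t = c * (k%:R * eps) ->
  0 <= t ->
  cone (mix i (copies (k := k) p)) xone (t *: xone - c *: ydir RR i).
Proof.
move=> hp p1 pt ap c0 taue tE t0 s s0.
have T0 : 0 < t + s by lra.
set Z := cM _.
have pT : p (cM (const_mx (t + s))) = ((t + s) ^+ d)%:C%C.
  have -> : cM (const_mx (t + s)) = ((t + s)%:C)%C *: cM (const_mx 1) :> 'rV_m.
    by rewrite -cMZ; congr cM; apply/matrixP => a b; rewrite !mxE mulr1.
  by rewrite hp ?rc_neq0 ?gt_eqF // p1 mulr1 -rmorphXn.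
have pTd : p (cM (const_mx (t + s)) + delta_mx 0 i) =
    ((t + s) ^+ d * (1 + tau / (t + s)))%:C%C.
  have -> : cM (const_mx (t + s)) + delta_mx 0 i = ((t + s)%:C)%C *:
     (cM (const_mx 1) + ((t + s)^-1%:C)%C *: delta_mx 0 i) :> 'rV_m.
    by mxfield; rewrite -rmorphD rc_neq0 gt_eqF.
  rewrite hp ?rc_neq0 ?gt_eqF // ap p1 pt -rmorphXn.
  rewrite -(rmorph1 rc) -!rmorphB -!rmorphM -rmorphD -rmorphM /=.
  by congr (_ %:C)%C; ring.
have rowZ j : row (lift ord0 j) Z = cM (const_mx (t + s)).
  rewrite cM_row; congr cM; apply/matrixP => a b; rewrite !mxE /=; ring.
have rowZd (j j' : 'I_k) : row (lift ord0 j') (Z + xdir CC j i) =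
    cM (const_mx (t + s)) + (j' == j)%:R *: delta_mx 0 i.
  rewrite -(rowZ j'); apply/matrixP => a b.
  by rewrite !mxE (inj_eq lift_inj) (ord1 a) eqxx /=; case: (j' == j); case: (b == i);
    rewrite /= ?mulr0 ?mulr1.
have FZ : copies p Z = ((t + s) ^+ (d * k))%:C%C.
  rewrite /copies; under eq_bigr do rewrite rowZ pT.
  by rewrite prodr_const card_ord -rmorphXn exprM.
have FZd j : copies p (Z + xdir CC j i) =
    ((t + s) ^+ (d * k) * (1 + tau / (t + s)))%:C%C.
  rewrite /copies (bigD1 j) //= rowZd eqxx scale1r pTd.
  under eq_bigr => j' jj' do rewrite rowZd (negPf jj') scale0r addr0 pT.
  rewrite prodr_const -rmorphXn -rmorphM mulrAC -exprS exprM.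
  suff -> : (#|[pred j0 | j0 != j]|.+1 = k)%N by [].
  by have := cardC1 j; rewrite card_ord => ->; rewrite prednK //; case: (k) j => // -[].
have Zi : Z ord0 i = (- c)%:C%C.
  by rewrite !mxE !eqxx /=; congr (_ %:C)%C; ring.
(* The k rows contribute equally, giving D_i F / F = k tau / (t + s). The value t = c k eps is the
   least that keeps this below 1/c for all s > 0 and all tau up to eps. *)
have -> : mix i (copies p) Z =
   ((t + s) ^+ (d * k) * (1 - c * (k%:R * tau) / (t + s)))%:C%C.
  rewrite /mix /grad FZ Zi.
  under eq_bigr do rewrite FZd.
  rewrite sumr_const card_ord -rmorphB -rmorphMn -rmorphM -rmorphD /=.
  by congr (_ %:C)%C; rewrite -mulr_natl; ring.
rewrite rc_neq0 mulf_neq0 ?expf_neq0 ?gt_eqF // subr_gt0 ltr_pdivrMr // mul1r.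
apply: le_lt_trans (_ : t < _); last by lra.
by rewrite tE ler_wpM2l // ler_wpM2l ?ler0n.
Qed.

(** * Eigenvalues of hyperbolic polynomials *)

Definition complexified n (h : {mpoly RR[n]}) (z : 'rV[CC]_n) : CC :=
  mmap rc (fun j => z 0 j) h.

Lemma complexified_real n (h : {mpoly RR[n]}) x : complexified h (cM x) = (ev h x)%:C%C.
Proof.
rewrite /complexified /ev /meval !/(mmap _ _ _) rmorph_sum; apply: eq_bigr => M _.
rewrite /= rmorphM /= /mmap1 rmorph_prod; congr (_ * _).
by apply: eq_bigr => i _; rewrite mxE rmorphXn.
Qed.

Lemma complexified_bipoly n (h : {mpoly RR[n]}) : bipoly (complexified h).
Proof.
apply: bipoly_sum => M; apply: bipolyM; first exact: bipoly_const.
by apply: bipoly_prod => i; apply: bipolyX; apply: bipoly_entry.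
Qed.

Lemma complexified_homf n d (h : {mpoly RR[n]}) :
  h \is d.-homog -> homf d (complexified h).
Proof.
move=> hh c z c0; rewrite /complexified /mmap mulr_sumr.
apply: eq_big_seq => M Min; rewrite [RHS]mulrCA; congr (_ * _).
have <- : mdeg M = d.
  by move: hh; rewrite dhomogE => /allP /(_ M Min) /= /eqP.
rewrite mdegE -prodrXr -big_split; apply: eq_bigr => i _.
by rewrite mxE exprMn.
Qed.

Lemma complexified_real_fun n (h : {mpoly RR[n]}) : real_fun (complexified h).
Proof. by move=> X; rewrite complexified_real complex_real. Qed.

Lemma restr_polyE n (h : {mpoly RR[n]}) e x (t : CC) :
  (map_poly rc (restr_poly h e x)).[t] = complexified h (t *: cM e - cM x).
Proof.
rewrite /restr_poly /complexified /mmap rmorph_sum horner_sum.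
apply: eq_bigr => M _; rewrite rmorphM hornerM /= map_polyC hornerC.
congr (_ * _); rewrite /mmap1 rmorph_prod horner_prod.
apply: eq_bigr => i _; rewrite rmorphXn horner_exp; congr (_ ^+ _).
rewrite !mxE rmorphB /= map_polyC hornerD hornerN hornerC.
by rewrite map_polyZ map_polyX hornerZ hornerX mulrC.
Qed.

Lemma restr_poly_horner n (h : {mpoly RR[n]}) e x (t : RR) :
  (restr_poly h e x).[t] = ev h (t *: e - x).
Proof.
apply: complexI; rewrite -horner_map restr_polyE -complexified_real.
by rewrite cMD cMN cMZ.
Qed.

Lemma prodr_const_seq (R : pzRingType) (I : Type) (s : seq I) (x : R) :
  \prod_(l <- s) x = x ^+ size s.
Proof. by elim: s => [|l s IH]; rewrite ?big_nil // big_cons IH exprS. Qed.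

Section Hyperbolic.
Variables (n d : nat) (h : {mpoly RR[n]}) (e : 'rV[RR]_n).
Hypotheses (hh : h \is d.-homog) (he : hyperbolic h e).

Let he0 : ev h e != 0 := proj1 he.

Lemma ev_scale (c : RR) x : c != 0 -> ev h (c *: x) = c ^+ d * ev h x.
Proof.
move=> c0; apply: complexI; rewrite -complexified_real cMZ.
by rewrite (complexified_homf hh) ?rc_neq0 // complexified_real -rmorphXn -rmorphM.
Qed.

Lemma hyperbolic_dir : hyp_dir (complexified h) e.
Proof.
move=> X; apply/eqP => H; have := proj2 he (- X) ii.
rewrite -[(fun a : RR => _)]/(rc : RR -> CC) rootE restr_polyE cMN opprK addrC H eqxx.
by move=> /(_ isT) /= /eqP; rewrite oner_eq0.
Qed.

Lemma reversed_restr x : exists B : {poly RR}, forall s : CC,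
  complexified h (cM e + s *: cM x) = (map_poly rc B).[s].
Proof.
have [P [hP _]] := real_line e x (complexified_bipoly h) (@complexified_real_fun _ h).
by exists P.
Qed.

Lemma poly_eq_nonzero (P Q : {poly RR}) :
  (forall t : RR, t != 0 -> P.[t] = Q.[t]) -> P = Q.
Proof.
move=> PQ; apply: (map_poly_inj rc); apply/eqP; rewrite -subr_eq0; apply/eqP.
apply: (@poly_eq0_growth _ 0) => t t1.
rewrite hornerD hornerN !(horner_map rc) PQ ?subrr ?Normc.normc0 ?mulr0 //.
by rewrite gt_eqF //; lra.
Qed.

(** The degree of [restr_poly] is not known in advance. Homogeneity relates it to the reversal t ->
    h(e + t x), whose value at 0 is h(e) != 0; comparing powers of -t then forces exactly d
    factors. *)
Lemma split_restr x (lc : RR) s :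
  restr_poly h e x = lc%:P * \prod_(l <- s) ('X - l%:P) ->
  [/\ size s = d, lc = ev h e &
    forall c : CC, complexified h (cM e + c *: cM x) =
       (ev h e)%:C%C * \prod_(l <- s) (1 + c * l%:C%C)].
Proof.
move=> rE; have [B hB] := reversed_restr x.
pose C : {poly RR} := lc%:P * \prod_(l <- s) (1 + l%:P * 'X).
have B0 : B.[0] = ev h e.
  apply: complexI; rewrite -horner_map rmorph0 -hB scale0r addr0.
  by rewrite complexified_real.
have C0 : C.[0] = lc.
  rewrite /C hornerM hornerC horner_prod big1 ?mulr1 // => l _.
  by rewrite !hornerE.
pose Y : {poly RR} := - 'X.
have Y0 : Y != 0 by rewrite oppr_eq0 polyX_eq0.
have key : Y ^+ size s * B = Y ^+ d * C.
  apply: poly_eq_nonzero => t t0; have tn0 : - t != 0 by rewrite oppr_eq0.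
  rewrite !hornerM !horner_exp /Y hornerN hornerX.
  have -> : B.[t] = (- t) ^+ d * (restr_poly h e x).[(- t)^-1].
    rewrite restr_poly_horner -ev_scale //.
    apply: complexI; rewrite -horner_map -hB -cMZ -cMD complexified_real.
    by congr (ev h _)%:C%C; rewrite scalerBr scalerA mulfV // scale1r scaleNr opprK.
  rewrite mulrCA; congr (_ * _); rewrite rE /C !hornerM !hornerC mulrCA.
  congr (_ * _); rewrite !horner_prod -prodr_const_seq -big_split; apply: eq_bigr => l _ /=.
  by rewrite !hornerE; field.
have lc0 : lc != 0.
  apply: contraNneq he0 => l0; have /eqP := key.
  rewrite /C l0 mul0r mulr0 mulf_eq0 expf_eq0 (negPf Y0) andbF /= -B0.
  by move=> /eqP ->; rewrite horner0.
have BC : size s = d.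
  case: (ltngtP (size s) d) => // lt.
    have : B = Y ^+ (d - size s) * C.
      apply: (mulfI (expf_neq0 (size s) Y0)); rewrite mulrA -exprD subnKC //.
      exact: ltnW.
    move/(congr1 (horner^~ 0)); rewrite B0 hornerM horner_exp hornerN hornerX.
    by rewrite oppr0 expr0n subn_eq0 leqNgt lt mul0r => /eqP; rewrite (negPf he0).
  have : Y ^+ (size s - d) * B = C.
    apply: (mulfI (expf_neq0 d Y0)); rewrite mulrA -exprD subnKC //.
    exact: ltnW.
  move/(congr1 (horner^~ 0)); rewrite C0 hornerM horner_exp hornerN hornerX.
  rewrite oppr0 expr0n subn_eq0 leqNgt lt mul0r => /esym/eqP.
  by rewrite (negPf lc0).
have {}BC' : B = C by apply: (mulfI (expf_neq0 d Y0)); rewrite -{1}BC.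
have lcE : lc = ev h e by rewrite -B0 BC' C0.
split=> // c; rewrite hB BC' /C rmorphM hornerM /= map_polyC hornerC lcE.
congr (_ * _); rewrite rmorph_prod horner_prod; apply: eq_bigr => l _.
rewrite rmorphD rmorphM rmorph1 /= map_polyC map_polyX hornerD hornerM.
by rewrite !hornerC hornerX mulrC.
Qed.

Lemma eigs_spec x : eig_spec h e x (eigs h e x).
Proof.
apply: ClassicalEpsilon.epsilon_spec.
set P := map_poly rc (restr_poly h e x).
have [zs Pzs] := closed_field_poly_normal P.
have zr z : z \in zs -> complex.Im z = 0.
  move=> zin; apply: (proj2 he x z).
  rewrite -[(fun a : RR => _)]/(rc : RR -> CC) -/P rootE.
  by rewrite Pzs hornerZ horner_prod (big_rem z) //= hornerXsubC subrr mul0r mulr0.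
pose s := [seq complex.Re z | z <- zs].
have rE : restr_poly h e x = (lead_coef (restr_poly h e x))%:P *
    \prod_(l <- s) ('X - l%:P).
  apply: (map_poly_inj rc); rewrite -/P Pzs -mul_polyC rmorphM /= map_polyC /=.
  rewrite /P lead_coef_map; congr (_ * _).
  rewrite rmorph_prod big_map; apply: eq_big_seq => z zin.
  rewrite rmorphB /= map_polyX map_polyC /=; congr (_ - _%:P).
  by rewrite [LHS]complexE (zr z zin) mulr0 addr0.
by exists s; rewrite /eig_spec {1}rE; have [_ -> _] := split_restr rE.
Qed.

Lemma size_eigs x : size (eigs h e x) = d.
Proof. by have [] := split_restr (eigs_spec x). Qed.

Lemma complexified_eigs x (c : CC) : complexified h (cM e + c *: cM x) =
  (ev h e)%:C%C * \prod_(l <- eigs h e x) (1 + c * l%:C%C).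
Proof. by have [_ _ ->] := split_restr (eigs_spec x). Qed.

Lemma ev_eig x l : l \in eigs h e x -> ev h (l *: e - x) = 0.
Proof.
move=> lin; rewrite -restr_poly_horner (eigs_spec x) hornerM horner_prod.
by rewrite (big_rem l) //= hornerXsubC subrr mul0r mulr0.
Qed.

Lemma hcone_cone x : hcone h e x -> cone (complexified h) e x.
Proof.
move=> /allP hx t t0; rewrite complexified_real rc_neq0.
have -> : x + t *: e = t *: (e + t^-1 *: x) by mxfield; rewrite gt_eqF.
have tn0 : t != 0 by rewrite gt_eqF.
rewrite ev_scale // mulf_neq0 ?expf_neq0 //.
rewrite -rc_neq0 -complexified_real cMD cMZ complexified_eigs mulf_neq0 //.
  by rewrite rc_neq0.
rewrite prodf_seq_neq0; apply/allP => l lin /=.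
rewrite -(rmorph1 rc) -rmorphM -rmorphD rc_neq0 gt_eqF // ltr_pwDl //.
by apply: mulr_ge0 (hx l lin); rewrite invr_ge0 ltW.
Qed.

Lemma cone_eig_ge0 x l : cone (complexified h) e x -> l \in eigs h e x -> 0 <= l.
Proof.
move=> hx lin; rewrite leNgt; apply/negP => l0.
have := hx (- l); rewrite oppr_gt0 => /(_ l0).
have -> : x + - l *: e = -1 *: (l *: e - x) by mxring.
by rewrite complexified_real rc_neq0 ev_scale ?oppr_eq0 ?oner_eq0 // ev_eig // mulr0
  eqxx.
Qed.

End Hyperbolic.

(** At most one factor differs from t. The extra t on the left avoids the exponent [size s] - 1,
    which would fail for the empty list. *)
Lemma prod_rank_le1 (s : seq RR) (t c : CC) :
  (count (fun l => l != 0%R) s <= 1)%N ->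
  t * \prod_(l <- s) (t + c * l%:C%C) =
  t ^+ size s * (t + c * (\sum_(l <- s) l)%:C%C).
Proof.
elim: s => [|l s IH] /=.
  by rewrite !big_nil mulr0 addr0 mulr1 mul1r.
rewrite !big_cons; have [->|l0] := eqVneq l 0.
  rewrite !add0n add0r mulr0 addr0 => /IH h.
  by rewrite mulrCA h mulrA exprS.
rewrite add1n ltnS leqn0 eqn0Ngt -has_count => /hasPn z.
have -> : \prod_(j <- s) (t + c * j%:C%C) = t ^+ size s.
  rewrite -prodr_const_seq; apply: eq_big_seq => x xs.
  by move: (z x xs); rewrite negbK => /eqP ->; rewrite mulr0 addr0.
rewrite big1_seq ?addr0; last first.
  by move=> x /andP[_ xs]; move: (z x xs); rewrite negbK => /eqP.
by rewrite exprS; ring.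
Qed.

(** * Restriction to the span of the rank one vectors *)

Section Restriction.
Variables (n d m : nat) (h : {mpoly RR[n]}) (e : 'rV[RR]_n) (u : 'I_m -> 'rV[RR]_n).
Hypotheses (hh : h \is d.-homog) (he : hyperbolic h e).
Hypotheses (hc : forall i, hcone h e (u i)) (hr : forall i, (hrk h e (u i) <= 1)%N).
Hypothesis hs : \sum_(i < m) u i = e.

Let he0 : ev h e != 0 := proj1 he.
Let U : 'M[RR]_(m, n) := \matrix_i u i.

Definition restriction (z : 'rV[CC]_m) : CC :=
  ((ev h e)^-1)%:C%C * complexified h (z *m cM U).

Lemma mul_row_U (x : 'rV[RR]_m) : cM x *m cM U = cM (\sum_i x 0 i *: u i).
Proof.
rewrite /cM -map_mxM mulmx_sum_row; congr map_mx.
by apply: eq_bigr => i _; rewrite rowK.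
Qed.

Lemma mul_one_U : cM (const_mx 1) *m cM U = cM e.
Proof.
rewrite mul_row_U -hs; congr cM.
by apply: eq_bigr => i _; rewrite mxE scale1r.
Qed.

Lemma mul_delta_U i : delta_mx 0 i *m cM U = cM (u i).
Proof. by rewrite -rowE cM_row rowK. Qed.

Lemma restriction_bipoly : bipoly restriction.
Proof.
apply: bipolyM; first exact: bipoly_const.
exact: (bipoly_linear (mulmxr (cM U)) (complexified_bipoly h)).
Qed.

Lemma restriction_homf : homf d restriction.
Proof.
move=> c z c0; rewrite /restriction -scalemxAl (complexified_homf hh) //.
by rewrite mulrCA.
Qed.

Lemma restriction_real : real_fun restriction.
Proof.
move=> X; rewrite rpredM ?complex_real // mul_row_U.
exact: complexified_real_fun.
Qed.

Lemma restriction_cM x :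
  restriction (cM x) = ((ev h e)^-1 * ev h (\sum_i x 0 i *: u i))%:C%C.
Proof. by rewrite /restriction mul_row_U complexified_real -rmorphM. Qed.

Lemma restriction_one : restriction (cM (const_mx 1)) = 1.
Proof.
by rewrite /restriction mul_one_U complexified_real -rmorphM mulVf.
Qed.

Lemma cone_u i : cone (complexified h) e (u i).
Proof. exact: (hcone_cone hh he (hc i)). Qed.

Lemma cone_sum_u (x : 'I_m -> RR) : (forall i, 0 <= x i) ->
  cone (complexified h) e (\sum_i x i *: u i).
Proof.
move=> x0; have hd := hyperbolic_dir he; have hF := complexified_homf hh.
apply: (cone_sum (complexified_bipoly h) hF hd) => i _.
exact: (coneZ hF hd (cone_u i)).
Qed.

Lemma restriction_stable (z : 'rV[CC]_m) :
  (forall i, 0 < complex.Im (z 0 i)) -> restriction z != 0.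
Proof.
move=> z0; rewrite mulf_neq0 ?rc_neq0 ?invr_eq0 //.
pose x : 'rV[RR]_m := map_mx (@complex.Re RR) z.
pose y i := complex.Im (z 0 i).
(* A positive number below every y_i, meaningful even for m = 0. It splits the imaginary part into a
   cone vector plus [eta *: e], which is a hyperbolicity direction. *)
pose eta := (1 + \sum_i (y i)^-1)^-1.
have S0 : 0 <= \sum_i (y i)^-1.
  by apply: sumr_ge0 => i _; rewrite invr_ge0 ltW // z0.
have eta0 : 0 < eta by rewrite invr_gt0 ltr_pwDl.
have etay i : 0 <= y i - eta.
  rewrite subr_ge0 -[y i]invrK lef_pV2 ?posrE ?invr_gt0 ?z0 ?ltr_pwDl //.
  rewrite (bigD1 i) //= addrCA lerDl addr_ge0 // sumr_ge0 // => j _.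
  by rewrite invr_ge0 ltW // z0.
have := cone_hyp_dir (complexified_bipoly h) (complexified_homf hh)
  (hyperbolic_dir he) (cone_sum_u etay) eta0 (\sum_i x 0 i *: u i).
have -> : \sum_i (y i - eta) *: u i + eta *: e = \sum_i y i *: u i.
  rewrite -hs scaler_sumr -big_split; apply: eq_bigr => i _ /=.
  by rewrite -scalerDl subrK.
suff -> : z *m cM U = cM (\sum_i x 0 i *: u i) + ii *: cM (\sum_i y i *: u i) by [].
have -> : \sum_i y i *: u i = \sum_i (\row_j y j) 0 i *: u i.
  by apply: eq_bigr => i _; rewrite mxE.
rewrite -!mul_row_U scalemxAl -mulmxDl; congr (_ *m _).
by apply/matrixP => a i; rewrite !mxE (ord1 a) [LHS]complexE.
Qed.

Lemma restriction_axis (t c : CC) i : t != 0 ->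
  restriction (t *: cM (const_mx 1) + c *: delta_mx 0 i) * t =
  t ^+ d * (t + c * (htr h e (u i))%:C%C).
Proof.
move=> t0.
have -> : t *: cM (const_mx 1) + c *: delta_mx 0 i =
    t *: (cM (const_mx 1) + (c / t) *: delta_mx 0 i) :> 'rV_m.
  by mxfield.
rewrite restriction_homf // /restriction mulmxDl -scalemxAl mul_one_U mul_delta_U.
have E : ((ev h e)^-1)%:C%C * (ev h e)%:C%C = 1 :> CC.
  by rewrite -rmorphM mulVf // rmorph1.
rewrite (complexified_eigs hh he) (mulrA _ ((ev h e)%:C)%C) E mul1r -mulrA.
congr (_ * _).
have := prod_rank_le1 1 (c / t) (hr i); rewrite mul1r expr1n mul1r => ->.
by rewrite /htr; field.
Qed.

(** The rank hypothesis describes h only on lines t e + s u_i, hence affineness at the base point i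
    1; [affine_transfer] carries it to all others. *)
Lemma restriction_affine i : affine_along restriction (delta_mx 0 i).
Proof.
apply: affine_transfer; first exact: restriction_bipoly.
  exact: restriction_stable.
exists (ii ^+ d), (ii ^+ d * (htr h e (u i))%:C%C / ii) => s.
have := restriction_axis s i ii_neq0.
have -> : ii *: cM (const_mx 1) = const_mx ii :> 'rV[CC]_m.
  by apply/matrixP => a b; rewrite !mxE rmorph1 mulr1.
move=> H; apply: (mulIf ii_neq0); rewrite H; field; exact: ii_neq0.
Qed.

Lemma restriction_delta i :
  restriction (cM (const_mx 1) + delta_mx 0 i) = (1 + htr h e (u i))%:C%C.
Proof.
have := restriction_axis 1 i (oner_neq0 CC).
by rewrite !scale1r mulr1 expr1n !mul1r rmorphD rmorph1.
Qed.

(* Euler's relation at the point 1, by comparing the linear terms of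
   p((1 + s) 1) = (1 + s)^d. *)
Lemma sum_htr : \sum_i htr h e (u i) = d%:R.
Proof.
have [R hR] := affine_first_order (index_enum 'I_m) (v := fun i => delta_mx 0 i)
  (cM (const_mx 1)) restriction_bipoly restriction_affine.
have one_sum : \sum_i delta_mx 0 i = cM (const_mx 1) :> 'rV[CC]_m.
  apply/matrixP => a b; rewrite summxE (bigD1 b) //= big1 => [|j jb].
    by rewrite !mxE (ord1 a) !eqxx addr0.
  by rewrite mxE [b == j]eq_sym (negPf jb) andbF.
pose tau : CC := \sum_i (htr h e (u i))%:C%C.
pose D : {poly CC} := (1 + 'X) ^+ d - (1 + 'X * tau%:P + 'X ^+ 2 * R).
have D0 : D = 0.
  apply: (@poly_eq0_growth _ 0) => t t1.
  have := hR (t%:C)%C; rewrite one_sum restriction_one.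
  have -> : \sum_(i <- index_enum 'I_m)
      (restriction (cM (const_mx 1) + delta_mx 0 i) - 1) = tau.
    apply: eq_bigr => i _; rewrite restriction_delta rmorphD rmorph1.
    by rewrite addrAC subrr add0r.
  have t10 : 1 + (t%:C)%C != 0 :> CC.
    by rewrite -(rmorph1 rc) -rmorphD rc_neq0 gt_eqF //; lra.
  rewrite -{1}[cM _]scale1r -scalerDl restriction_homf // restriction_one mulr1.
  move=> H; rewrite /D !(hornerD, hornerN, hornerM, horner_exp, hornerX, hornerC) H.
  by rewrite subrr Normc.normc0 mulr0.
have := congr1 (fun P : {poly CC} => P^`().[0]) D0.
rewrite deriv0 horner0 /D.
rewrite !(derivB, derivD, derivM, derivX, derivC, deriv_exp).
rewrite !(hornerD, hornerN, hornerM, horner_exp, hornerX, hornerC, hornerMn).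
rewrite !(mul0r, mulr0, addr0, add0r, mul1r, expr1n) => /eqP.
rewrite subr_eq0 => /eqP H; apply: complexI; rewrite rmorph_nat rmorph_sum.
exact: esym.
Qed.

Lemma sum_part_cone (P : pred 'I_m) : cone (complexified h) e (\sum_(i | P i) u i).
Proof.
apply: (cone_sum (complexified_bipoly h) (complexified_homf hh)
  (hyperbolic_dir he)) => i _.
exact: cone_u.
Qed.

(** If k l >= T, the product of copies is nonzero at the interlacing point with parameter k l. Its
    row [j] maps to k (l e - x), with x the sum of block j, and h vanishes there when l is an
    eigenvalue of x. *)
Lemma partition_eigs_lt k (eps del c T : RR) :
  (0 < k)%N -> 0 < eps -> (forall i, htr h e (u i) <= eps) ->
  1 < del -> c * (del - 1) = del -> 0 < m%:R - 1 + c ->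
  (m%:R * (c * (k%:R * eps)) + (m%:R - 1) * del) / (m%:R - 1 + c) < T ->
  exists f : 'I_m -> 'I_k, forall j l,
    l \in eigs h e (\sum_(i < m | f i == j) u i) -> k%:R * l < T.
Proof.
move=> k0 eps0 tre d1 cd Q0 hT.
have kR0 : 0 < k%:R :> RR by rewrite ltr0n.
have d10 : 0 < del - 1 by lra.
have c0 : 0 < c by rewrite -(pmulr_lgt0 c d10) cd; lra.
pose F : 'M[CC]_(k.+1, m) -> CC := copies restriction.
have mF : mixable (d * k) F.
  apply: mixable_copies restriction_bipoly restriction_homf restriction_real _ _.
    exact: restriction_stable.
  exact: restriction_affine.
have F1 : 0 < reval F xone by rewrite reval_copies_xone ?restriction_one ?ltr01.
have yF i : yfree i F by exact: copies_yfree.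
pose t := c * (k%:R * eps).
have t0 : 0 <= t by rewrite !mulr_ge0 // ltW.
have start i : cone (mix i F) xone (t *: xone - c *: ydir RR i).
  apply: (copies_start restriction_homf restriction_one (restriction_delta i)
    restriction_affine (ltW c0) (tre i)) => //.
have [||f hf] := @interlacing k m _ (enum 'I_m) F (- yone) T mF F1 yF k0 (enum_uniq _).
- by move=> i; rewrite mxE yone_row0.
- move=> s Ts; rewrite addrC; apply: (mixes_gt0 mF F1 yF d1 cd start Q0).
  exact: lt_le_trans hT Ts.
exists f => j l lin; rewrite ltNge; apply/negP => /hf.
set Z := (X in reval F X) => FZ.
have {FZ} : F (cM Z) != 0 by rewrite reval_neq0 ?gt_eqF //; exact: mixable_real mF.
rewrite /F /copies => /prodf_neq0 /(_ j isT).
rewrite cM_row restriction_cM rc_neq0 mulf_eq0 negb_or => /andP[_] /eqP; apply.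
have -> : \sum_i (row (lift ord0 j) Z) 0 i *: u i =
    k%:R *: (l *: e - \sum_(i < m | f i == j) u i).
  rewrite -hs scaler_sumr [X in _ - X]big_mkcond -sumrB scaler_sumr.
  apply: eq_bigr => i _.
  have -> : (row (lift ord0 j) Z) 0 i = k%:R * l - k%:R * (f i == j)%:R.
    rewrite mxE /Z !mxE /yone summxE big1 => [|i' _]; last by rewrite mxE.
    rewrite summxE big_enum /= (bigD1 i) //= big1 => [|i' ii']; last first.
      by rewrite !mxE [i == i']eq_sym (negPf ii') andbF mulr0.
    rewrite !mxE (inj_eq lift_inj) eqxx andbT /= [j == _]eq_sym; ring.
  by case: (f i == j) => /=; mxring.
by rewrite (ev_scale hh) ?gt_eqF // (ev_eig hh he lin) mulr0.
Qed.

End Restriction.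

(** With mu = 1/m and r = del - 1 + mu, the bound is (1 - mu) r + (1 - mu) (alpha - mu (1 - mu)) / r
    plus a constant. It is least at r^2 = alpha - mu (1 - mu), where it equals del^2. *)
Lemma delta_optimal (m : nat) (alpha : RR) : (0 < m)%N -> m%:R^-1 < alpha ->
  let del := 1 - m%:R^-1 + Num.sqrt (alpha - m%:R^-1 * (1 - m%:R^-1)) in
  let c := del / (del - 1) in
  [/\ 1 < del, 0 < m%:R - 1 + c &
  (m%:R * (c * alpha) + (m%:R - 1) * del) / (m%:R - 1 + c) = delta alpha m].
Proof.
move=> m0 ha; rewrite /delta.
have mR : 0 < m%:R :> RR by rewrite ltr0n.
have m1 : 1 <= m%:R :> RR by rewrite ler1n.
set mu := m%:R^-1 in ha *.
have mu0 : 0 < mu by rewrite invr_gt0.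
have mmu : m%:R * mu = 1 by rewrite mulfV ?gt_eqF.
set r := Num.sqrt _.
(* Equivalent to mu < alpha; it gives r > mu, that is del > 1. *)
have A0 : mu ^+ 2 < alpha - mu * (1 - mu) by rewrite expr2; lra.
have r2 : r ^+ 2 = alpha - mu * (1 - mu).
  by rewrite sqr_sqrtr // ltW // (lt_trans _ A0) // exprn_gt0.
have r0 : 0 <= r by exact: sqrtr_ge0.
have rmu : mu < r by rewrite -(ltr_pXn2r (n := 2)) ?nnegrE ?(ltW mu0) // r2.
pose del := 1 - mu + r; pose c := del / (del - 1); rewrite -/del -/c.
have d1 : 1 < del by rewrite /del; lra.
have c0 : 0 < c by rewrite divr_gt0; lra.
have mE : m%:R = mu^-1 :> RR by rewrite invrK.
have Q0 : 0 < m%:R - 1 + c by lra.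
split=> //; apply: (mulIf (lt0r_neq0 Q0)).
rewrite divfK ?lt0r_neq0 //.
have aE : alpha = r ^+ 2 + mu * (1 - mu) by rewrite r2; lra.
rewrite aE /c /del mE; field.
by apply/andP; split; rewrite gt_eqF //; lra.
Qed.

(* The partition S_1 u ... u S_k = [m] is given by f : 'I_m -> 'I_k,
   S_j = [set i | f i == j]. *)
Theorem theorem1p3 (k : nat) (eps : RR) (n d m : nat)
  (h : {mpoly RR[n]}) (e : 'rV[RR]_n) (u : 'I_m -> 'rV[RR]_n) :
  (2 <= k)%N -> 0 < eps ->
  h \is d.-homog -> hyperbolic h e ->
  (forall i, hcone h e (u i)) ->
  (forall i, (hrk h e (u i) <= 1)%N) ->
  (forall i, htr h e (u i) <= eps) ->
  \sum_(i < m) u i = e ->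
  exists f : 'I_m -> 'I_k,
    forall j : 'I_k,
      hnorm h e (\sum_(i < m | f i == j) u i) <= (k%:R)^-1 * delta (k%:R * eps) m.
Proof.
move=> k2 eps0 hh he hc hr htr hs.
have k0 : (0 < k)%N by exact: ltnW.
have kR0 : 0 < k%:R :> RR by rewrite ltr0n.
set bound := _^-1 * _.
have bound0 : 0 <= bound by rewrite mulr_ge0 ?sqr_ge0 // invr_ge0 ltW.
(* In degree 0 there are no eigenvalues, and the empty maximum is 0. *)
have [d0|d0] := posnP d.
  exists (fun=> Ordinal k0) => j; rewrite /hnorm.
  have /size0nil -> : size (eigs h e (\sum_(i < m | Ordinal k0 == j) u i)) = 0%N.
    by rewrite (size_eigs hh he) d0.
  by rewrite big_nil.
(* The traces add up to d, which is now at least 1. *)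
have meps : 1 <= m%:R * eps.
  apply: le_trans (_ : d%:R <= _); first by rewrite ler1n.
  rewrite -(sum_htr hh he hc hr hs) -[m in leRHS](card_ord m) mulr_natl -sumr_const.
  exact: ler_sum.
have m0 : (0 < m)%N.
  by rewrite lt0n; apply: contraTneq meps => ->; rewrite mul0r -ltNge.
have mR0 : 0 < m%:R :> RR by rewrite ltr0n.
(* Here k >= 2 makes the inequality strict, as del > 1 requires. *)
have ha : m%:R^-1 < k%:R * eps.
  rewrite -(ltr_pM2l mR0) mulfV ?gt_eqF // mulrCA.
  have : 2 <= k%:R :> RR by rewrite ler_nat.
  nra.
have [d1 Q0 bE] := delta_optimal m0 ha.
set del := 1 - _ + _ in d1 Q0 bE; set c := del / _ in Q0 bE.
have cd : c * (del - 1) = del by rewrite divfK // gt_eqF //; lra.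
(* A minimiser [f0] exceeding [bound] would be beaten by the assignment obtained for T = k
   [norm f0], which lies beyond delta. *)
pose norm (f : {ffun 'I_m -> 'I_k}) :=
  \big[Num.max/0]_(j < k) hnorm h e (\sum_(i < m | f i == j) u i).
have [f0 _ f0min] := arg_minP norm (isT : predT [ffun=> Ordinal k0]).
have normE (f : {ffun 'I_m -> 'I_k}) j : hnorm h e (\sum_(i < m | f i == j) u i) <= norm f.
  exact: (le_bigmax _ (fun j => hnorm h e (\sum_(i < m | f i == j) u i))).
have [le|lt] := leP (norm f0) bound.
  by exists f0 => j; apply: le_trans le.
have lt' : delta (k%:R * eps) m < k%:R * norm f0.
  by rewrite mulrC -ltr_pdivrMr // mulrC.
have := partition_eigs_lt hh he hc hr hs k0 eps0 htr d1 cd Q0.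
rewrite bE => /(_ _ lt') [f hf].
have := f0min [ffun i => f i] isT; rewrite leNgt => /negP[].
have n0 : 0 < norm f0 by exact: le_lt_trans lt.
apply/bigmax_ltP; split=> // j _.
have -> : \sum_(i < m | [ffun i => f i] i == j) u i = \sum_(i < m | f i == j) u i.
  by apply: eq_bigl => i; rewrite ffunE.
rewrite /hnorm big_seq; apply: bigmax_lt => // l lin.
rewrite ger0_norm; last exact: (cone_eig_ge0 hh he (sum_part_cone hh he hc _) lin).
by rewrite -(ltr_pM2l kR0) (hf j).
Qed.
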